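(* Let $E$ be a finite directed graph, and let $A\in M_{E^0}(\mathbb{N})$ be the vertex matrix with entries $A(v,w)=|vE^1w|$. Let $\gamma:\mathbb{T}\to\operatorname{Aut}\mathcal{T}C^*(E)$ be the gauge action, and define $\alpha:\mathbb{R}\to\operatorname{Aut}\mathcal{T}C^*(E)$ by $\alpha_t=\gamma_{e^{it}}$. Let $\beta\in\mathbb{R}$. (a) A state $\phi$ of $\mathcal{T}C^*(E)$ is a KMS$_\beta$ state of $(\mathcal{T}C^*(E),\alpha)$ if and only if $$\phi(s_\mu s_\nu^* )=\delta_{\mu,\nu}e^{-\beta|\mu|}\phi(p_{s(\mu)})\quad\text{for all }\mu,\nu\in E^*.$$ (b) A state $\phi$ of $\mathcal{T}C^*(E)$ is a ground state of $(\mathcal{T}C^*(E),\alpha)$ if and only if $\phi(s_\mu s_\nu^* )=0$ whenever $|\mu|>0$ or $|\nu|>0$. (c) Suppose that $\phi$ is a KMS$_\beta$ state of $(\mathcal{T}C^*(E),\alpha)$, and define $m^\phi=(m^\phi_v)\in[0,\infty)^{E^0}$ by $m^\phi_v=\phi(p_v)$. Then $m^\phi$ is a probability measure on $E^0$ satisfying the subinvariance relation $Am^\phi\le e^\beta m^\phi$ (entrywise). (d) A KMS$_\beta$ state $\phi$ of $(\mathcal{T}C^*(E),\alpha)$ factors through $C^*(E)$ if and only if $(Am^\phi)_v=e^\beta m^\phi_v$ whenever $v\in E^0$ is not a source, where $m^\phi_v=\phi(p_v)$.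
   Context: Graphs. A directed graph $E=(E^0,E^1,r,s)$ has a (nonempty) vertex set $E^0$, edge set $E^1$, and range and source maps $r,s:E^1\to E^0$; it is finite if $E^0$ and $E^1$ are finite. A path of length $n\ge 1$ is $\mu=\mu_1\cdots\mu_n$ with $\mu_i\in E^1$ and $s(\mu_i)=r(\mu_{i+1})$; $r(\mu)=r(\mu_1)$, $s(\mu)=s(\mu_n)$, $|\mu|=n$. Vertices are paths of length $0$ with $r(v)=s(v)=v$. $E^*$ is the set of all finite paths; $vE^1w=\{e\in E^1:r(e)=v,\ s(e)=w\}$, $vE^1=\{e\in E^1:r(e)=v\}$. A source is a vertex $v$ with $vE^1=\emptyset$. $\mathbb{N}$ contains $0$. Algebras. A Toeplitz-Cuntz-Krieger $E$-family consists of mutually orthogonal projections $\{P_v:v\in E^0\}$ and partial isometries $\{S_e:e\in E^1\}$ with $S_e^*S_e=P_{s(e)}$ and $P_v\ge\sum_{e\in F}S_eS_e^*$ for every $v\in E^0$ and every finite $F\subset vE^1$. $\mathcal{T}C^*(E)$ is the $C^*$-algebra generated by a universal such family $(p,s)$. For $\mu=\mu_1\cdots\mu_n$, $s_\mu=s_{\mu_1}\cdots s_{\mu_n}$, and $s_v=p_v$ for $v\in E^0$; $\mathcal{T}C^*(E)$ is the closed span of the elements $s_\mu s_\nu^*$. $C^*(E)$ is the quotient of $\mathcal{T}C^*(E)$ by the ideal $J$ generated by $\{p_v-\sum_{f\in vE^1}s_fs_f^*:v\in E^0,\ vE^1\ne\emptyset\}$, with quotient map $q$. A state $\phi$ of $\mathcal{T}C^*(E)$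 factors through $C^*(E)$ if $\phi=\bar\phi\circ q$ for some state $\bar\phi$ of $C^*(E)$. The gauge action satisfies $\gamma_z(s_\mu s_\nu^* )=z^{|\mu|-|\nu|}s_\mu s_\nu^*$ $(z\in\mathbb{T})$; so $\alpha_z(s_\mu s_\nu^* )=e^{iz(|\mu|-|\nu|)}s_\mu s_\nu^*$ is defined for all $z\in\mathbb{C}$. KMS and ground states. For $\beta\in\mathbb{R}\setminus\{0\}$, a state $\phi$ is a KMS$_\beta$ state if $\phi(ab)=\phi(b\,\alpha_{i\beta}(a))$ for all $\alpha$-analytic $a,b$ (equivalently for all $a,b\in\{s_\mu s_\nu^*:\mu,\nu\in E^*\}$). KMS$_0$ states are the $\alpha$-invariant tracial states. A state $\phi$ is a ground state if for all $a,b\in\{s_\mu s_\nu^*:\mu,\nu\in E^*\}$ the function $z\mapsto\phi(a\,\alpha_z(b))$ is bounded on the upper half-plane. *)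

(* Defs.v *)
From HB Require Import structures.
From mathcomp Require Import all_boot all_order all_algebra.
From mathcomp Require Import all_classical all_reals all_analysis.
From mathcomp Require Import complex.

Set Implicit Arguments.
Unset Strict Implicit.
Unset Printing Implicit Defensive.

Import Order.TTheory GRing.Theory Num.Theory.
Import numFieldNormedType.Exports.

Local Open Scope classical_set_scope.
Local Open Scope complex_scope.
Local Open Scope ring_scope.

(** * C*-algebras

    C*-algebras are not assumed unital.  Norms over [R[i]] take values in
    [R[i]]; there [x <= y] means that [y - x] is a nonnegative real, so every
    norm is a nonnegative real number. *)

HB.mixin Record CompleteNormedModule_isCstarAlgebra (R : realType) A
    of CompleteNormedModule R[i] A := {
  cmul : A -> A -> A;
  star : A -> A;
  cmulA : associative cmul;
  cmulDl : left_distributive cmul +%R;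
  cmulDr : right_distributive cmul +%R;
  cmulZl : forall (k : R[i]) x y, cmul (k *: x) y = k *: cmul x y;
  cmulZr : forall (k : R[i]) x y, cmul x (k *: y) = k *: cmul x y;
  starK : involutive star;
  starD : forall x y, star (x + y) = star x + star y;
  starZ : forall (k : R[i]) x, star (k *: x) = (conjc k) *: star x;
  starM : forall x y, star (cmul x y) = cmul (star y) (star x);
  cmul_norm : forall x y, `|cmul x y| <= `|x| * `|y|;
  cstar_norm : forall x, `|cmul (star x) x| = `|x| ^+ 2
}.

#[short(type="cstarAlgType")]
HB.structure Definition CstarAlgebra (R : realType) :=
  {A of CompleteNormedModule_isCstarAlgebra R A & CompleteNormedModule R[i] A}.

Declare Scope cstar_scope.
Delimit Scope cstar_scope with cstar.
Notation "x ** y" := (cmul x y) (at level 40, left associativity) : cstar_scope.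
Local Open Scope cstar_scope.

Definition cpositive (R : realType) (A : cstarAlgType R) (x : A) : Prop :=
  exists c, x = star c ** c.

Definition cle (R : realType) (A : cstarAlgType R) (x y : A) : Prop :=
  cpositive (y - x).

Definition is_projection (R : realType) (A : cstarAlgType R) (x : A) : Prop :=
  star x = x /\ x ** x = x.

Definition is_partial_isometry (R : realType) (A : cstarAlgType R) (x : A) :
  Prop := x ** star x ** x = x.

Definition is_starhom (R : realType) (A B : cstarAlgType R) (f : A -> B) :
    Prop :=
  [/\ forall (k : R[i]) x y, f (k *: x + y) = k *: f x + f y,
      forall x y, f (x ** y) = f x ** f y
    & forall x, f (star x) = star (f x)].

Definition is_automorphism (R : realType) (A : cstarAlgType R) (f : A -> A) :
  Prop := is_starhom f /\ bijective f.

Definition is_subspace (R : realType) (A : cstarAlgType R) (D : set A) : Prop :=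
  D 0 /\ forall (k : R[i]) x y, D x -> D y -> D (k *: x + y).

Definition is_sub_cstar (R : realType) (A : cstarAlgType R) (D : set A) :
    Prop :=
  [/\ closed D, is_subspace D, forall x y, D x -> D y -> D (x ** y)
    & forall x, D x -> D (star x)].

Definition cstar_generates (R : realType) (A : cstarAlgType R) (G : set A) :
  Prop := forall D : set A, is_sub_cstar D -> G `<=` D -> D = setT.

Definition is_closed_ideal (R : realType) (A : cstarAlgType R) (I : set A) :
    Prop :=
  [/\ closed I, is_subspace I & forall a x, I x -> I (a ** x) /\ I (x ** a)].

Definition ideal_generated (R : realType) (A : cstarAlgType R) (G : set A) :
  set A := [set x | forall I : set A, is_closed_ideal I -> G `<=` I -> I x].

(** [q : A -> B] exhibits [B] as [A / J] with its quotient norm. *)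
Definition is_quotient_map (R : realType) (A B : cstarAlgType R) (J : set A)
    (q : A -> B) : Prop :=
  [/\ is_starhom q,
      forall b, exists a, q a = b,
      forall a, q a = 0 <-> J a
    & forall a, complex.Re `|q a| = inf [set complex.Re `|a + j| | j in J]].

(** [sup] is 0 on sets that are empty or unbounded, so [functional_norm phi = 1]
    does entail that [phi] is bounded. *)
Definition functional_norm (R : realType) (A : cstarAlgType R)
    (phi : {scalar A}) : R :=
  sup [set complex.Re `|phi a| | a in [set a : A | `|a| <= 1]].

Definition is_state (R : realType) (A : cstarAlgType R) (phi : {scalar A}) :
    Prop :=
  (forall a, cpositive a -> 0 <= phi a) /\ functional_norm phi = 1.

(** * KMS and ground states of a dynamics [alpha : R -> Aut A] *)

(** Analytic on the whole of the complex plane: a norm-convergent power series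
    expansion around every point. *)
Definition entire (R : realType) (A : cstarAlgType R) (F : R[i] -> A) : Prop :=
  forall z0 : R[i], exists r : R, 0 < r /\ exists c : nat -> A,
    forall z : R[i], `|z - z0| < r%:C ->
      (fun n : nat => \sum_(k < n) (z - z0) ^+ k *: c k) @ \oo --> F z.

(** [F] plays the role of [z |-> alpha_z a]. *)
Definition entire_extension (R : realType) (A : cstarAlgType R)
    (alpha : R -> A -> A) (a : A) (F : R[i] -> A) : Prop :=
  entire F /\ forall t : R, F t%:C = alpha t a.

Definition is_analytic (R : realType) (A : cstarAlgType R)
    (alpha : R -> A -> A) (a : A) : Prop :=
  exists F, entire_extension alpha a F.

Definition is_KMS_state (R : realType) (A : cstarAlgType R)
    (alpha : R -> A -> A) (beta : R) (phi : {scalar A}) : Prop :=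
  is_state phi /\
  if beta == 0 then
    (forall a b, phi (a ** b) = phi (b ** a)) /\
    (forall t a, phi (alpha t a) = phi a)
  else
    forall a b F, entire_extension alpha a F -> is_analytic alpha b ->
      phi (a ** b) = phi (b ** F (0 +i* beta)).

(** [D] is the set of analytic elements on which the condition is tested. *)
Definition is_ground_state (R : realType) (A : cstarAlgType R)
    (alpha : R -> A -> A) (D : set A) (phi : {scalar A}) : Prop :=
  is_state phi /\
  forall a b F, D a -> D b -> entire_extension alpha b F ->
    exists M : R, forall z : R[i],
      0 < complex.Im z -> `|phi (a ** F z)| <= M%:C.

(** * Finite directed graphs *)

Record digraph := Digraph {
  vertex : finType;
  edge : finType;
  rng : edge -> vertex;
  src : edge -> vertex;
  vertex_nonempty : (0 < #|vertex|)%N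
}.

Definition is_source (E : digraph) (v : vertex E) : Prop :=
  forall e : edge E, rng e <> v.

Definition vertex_matrix (E : digraph) (v w : vertex E) : nat :=
  #|[set e : edge E | (rng e == v) && (src e == w)]|.

(** The path mu_1 ... mu_n is encoded as the pair of its range r(mu_1) and the
    sequence of its edges; the vertex v, of length 0, is [(v, [::])]. *)
Fixpoint is_path (E : digraph) (v : vertex E) (es : seq (edge E)) : bool :=
  if es is e :: es' then (rng e == v) && is_path (src e) es' else true.

Definition gpath (E : digraph) : Type :=
  {x : vertex E * seq (edge E) | is_path x.1 x.2}.

Definition path_src (E : digraph) (mu : gpath E) : vertex E :=
  last (val mu).1 (map (@src E) (val mu).2).

Definition path_len (E : digraph) (mu : gpath E) : nat := size (val mu).2.

(** * Toeplitz-Cuntz-Krieger families and the algebras of a graph *)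

Definition is_TCK_family (R : realType) (E : digraph) (A : cstarAlgType R)
    (P : vertex E -> A) (S : edge E -> A) : Prop :=
  (forall v, is_projection (P v)) /\
  (forall v w, v != w -> P v ** P w = 0) /\
  (forall e, is_partial_isometry (S e)) /\
  (forall e, star (S e) ** S e = P (src e)) /\
  (forall v (F : {set edge E}), (forall e, e \in F -> rng e = v) ->
     cle (\sum_(e in F) S e ** star (S e)) (P v)).

(** [(A, p, s)] is the Toeplitz algebra of [E] with its canonical family;
    [pi] below is unique because the family generates [A]. *)
Definition is_toeplitz_algebra (R : realType) (E : digraph)
    (A : cstarAlgType R) (p : vertex E -> A) (s : edge E -> A) : Prop :=
  [/\ is_TCK_family p s,
      cstar_generates (range p `|` range s)
    & forall (B : cstarAlgType R) (P : vertex E -> B) (S : edge E -> B),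
        is_TCK_family P S ->
        exists pi : A -> B,
          [/\ is_starhom pi, forall v, pi (p v) = P v
            & forall e, pi (s e) = S e]].

Definition s_path (R : realType) (E : digraph) (A : cstarAlgType R)
    (p : vertex E -> A) (s : edge E -> A) (mu : gpath E) : A :=
  if (val mu).2 is e :: es then foldl (fun a f => a ** s f) (s e) es
  else p (val mu).1.

Definition span_elt (R : realType) (E : digraph) (A : cstarAlgType R)
    (p : vertex E -> A) (s : edge E -> A) (mu nu : gpath E) : A :=
  s_path p s mu ** star (s_path p s nu).

Definition span_elts (R : realType) (E : digraph) (A : cstarAlgType R)
    (p : vertex E -> A) (s : edge E -> A) : set A :=
  [set x | exists mu nu, x = span_elt p s mu nu].

(** Kernel of the quotient map from the Toeplitz algebra to C*(E). *)
Definition CK_ideal (R : realType) (E : digraph) (A : cstarAlgType R)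
    (p : vertex E -> A) (s : edge E -> A) : set A :=
  ideal_generated [set x | exists v, ~ is_source v /\
    x = p v - \sum_(f | rng f == v) s f ** star (s f)].

(** The circle is the set of [z : R[i]] of modulus 1; the values of [gamma]
    elsewhere are irrelevant. *)
Definition is_gauge_action (R : realType) (E : digraph) (A : cstarAlgType R)
    (p : vertex E -> A) (s : edge E -> A) (gamma : R[i] -> A -> A) : Prop :=
  [/\ forall z, `|z| = 1 -> is_automorphism (gamma z),
      forall z w a, `|z| = 1 -> `|w| = 1 ->
        gamma (z * w) a = gamma z (gamma w a)
    & forall z mu nu, `|z| = 1 ->
        gamma z (span_elt p s mu nu) =
        z ^ ((path_len mu)%:Z - (path_len nu)%:Z) *: span_elt p s mu nu].

Definition gauge_dynamics (R : realType) (A : cstarAlgType R)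
    (gamma : R[i] -> A -> A) (t : R) : A -> A :=
  gamma (cos t +i* sin t).

Definition factors_through (R : realType) (A B : cstarAlgType R) (q : A -> B)
    (phi : {scalar A}) : Prop :=
  exists psi : {scalar B}, is_state psi /\ forall a, phi a = psi (q a).

Definition vertex_weights (R : realType) (E : digraph) (A : cstarAlgType R)
    (p : vertex E -> A) (phi : {scalar A}) (v : vertex E) : R[i] :=
  phi (p v).

Definition vertex_matrix_mul (R : realType) (E : digraph)
    (m : vertex E -> R[i]) (v : vertex E) : R[i] :=
  \sum_w (vertex_matrix v w)%:R * m w.

(** A measure on the finite set of vertices, given by its point masses. *)
Definition is_probability (R : realType) (E : digraph)
    (m : vertex E -> R[i]) : Prop :=
  (forall v, 0 <= m v) /\ \sum_v m v = 1.

(* Main.v *)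
(* The relations S_e^* S_f = 0 (e <> f) and P_(r(e)) S_e = S_e need the absence
   of negative squares, w^* w = - k^2 with k self-adjoint implies k = 0; this is
   proved without spectral theory, from the operator norm on the unitization, a
   square root obtained as a fixed point, and the extremality of the unit in the
   unit ball.  The elements s_mu s_nu^* then span a dense subspace on which both
   dynamics and states are explicit.  A functional satisfying the formula in (a)
   obeys phi (a b) = e^(beta n) phi (b a) for all a and every b homogeneous of
   degree n, since it suffices to check this for b = p_v, s_e, s_e^* ; the KMS
   condition for an arbitrary analytic element follows because
   z |-> phi (b alpha_z(a)) and a multiple of e^(-inz) agree on the real line,
   hence everywhere by the identity theorem.  For (d), p_v - sum s_f s_f^* is
   of the form c^* c, and phi (c^* c) = 0 propagates to the ideal by
   Cauchy-Schwarz and the twisted trace property. *)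

Require Import Defs.
From HB Require Import structures.
From mathcomp Require Import all_boot all_order all_algebra.
From mathcomp Require Import all_classical all_reals all_analysis.
From mathcomp Require Import complex ring lra.

Set Implicit Arguments.
Unset Strict Implicit.
Unset Printing Implicit Defensive.

Import Order.TTheory GRing.Theory Num.Theory.
Import numFieldNormedType.Exports.

Local Open Scope classical_set_scope.
Local Open Scope complex_scope.
Local Open Scope ring_scope.
Local Open Scope cstar_scope.

(** * Real-valued norms *)

(** The order is purely algebraic: [cle x y] only says that [y - x] is some c^* c, and nothing is
    known beforehand about signs of such elements. Compressing a defect c^* c by a suitable element
    turns a failure of the wanted relation into w^* w = - k^2. Signs are then expressed by norms:
    for small self-adjoint h, contractivity of b |-> b + h b stands for h <= 0. The delicate point
    is to pass from the sign of w^* w to that of w w^* ; the usual argument compares spectra, and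
    here growth rates of powers take that role. A unit is adjoined formally because the sum of the
    p_v is recognized as a unit only after these relations. The extensions in the KMS and ground
    conditions are arbitrary entire functions, given by local expansions of unspecified radius;
    zeros are therefore propagated from the real line along segments. *)

Definition nrm (R : realType) (V : normedZmodType R[i]) (x : V) : R :=
  complex.Re `|x|.

Section RealNorm.
Context {R : realType}.
Implicit Types (V : normedZmodType R[i]).

Lemma nrmE V (x : V) : `|x| = (nrm x)%:C.
Proof. by rewrite /nrm RRe_real // realE normr_ge0. Qed.

Lemma nrm_ge0 V (x : V) : 0 <= nrm x.
Proof. by rewrite -ler0c -nrmE normr_ge0. Qed.

Lemma nrm0 V : nrm (0 : V) = 0.
Proof. by rewrite /nrm normr0. Qed.

Lemma nrm_eq0 V (x : V) : (nrm x == 0) = (x == 0).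
Proof. by rewrite -(inj_eq (@complexI R)) -nrmE normr_eq0. Qed.

Lemma nrmN V (x : V) : nrm (- x) = nrm x.
Proof. by rewrite /nrm normrN. Qed.

Lemma nrmD V (x y : V) : nrm (x + y) <= nrm x + nrm y.
Proof. by rewrite -lecR rmorphD /= -!nrmE ler_normD. Qed.

Lemma nrmB V (x y : V) : nrm (x - y) <= nrm x + nrm y.
Proof. by rewrite (le_trans (nrmD _ _)) // nrmN. Qed.

Lemma nrmBC V (x y : V) : nrm (x - y) = nrm (y - x).
Proof. by rewrite -nrmN opprB. Qed.

Lemma nrm_distD V (y x z : V) : nrm (x - z) <= nrm (x - y) + nrm (y - z).
Proof. by rewrite (le_trans _ (nrmD _ _)) // addrA subrK. Qed.

Lemma nrm_sum V (I : Type) (s : seq I) (P : pred I) (F : I -> V) :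
  nrm (\sum_(i <- s | P i) F i) <= \sum_(i <- s | P i) nrm (F i).
Proof.
elim/big_ind2: _ => [|x x' y y' hx hy|//]; first by rewrite nrm0.
exact: le_trans (nrmD _ _) (lerD hx hy).
Qed.

Lemma nrmZ (V : normedModType R[i]) (k : R[i]) (x : V) :
  nrm (k *: x) = nrm k * nrm x.
Proof. by apply: complexI; rewrite rmorphM /= -!nrmE normrZ. Qed.

Lemma nrmcM (k l : R[i]) : nrm (k * l) = nrm k * nrm l.
Proof. by apply: complexI; rewrite rmorphM /= -!nrmE normrM. Qed.

Lemma nrmc1 : nrm (1 : R[i]) = 1.
Proof. by rewrite /nrm normr1. Qed.

Lemma nrmcX (k : R[i]) n : nrm (k ^+ n) = nrm k ^+ n.
Proof. by elim: n => [|n IH]; rewrite ?expr0 ?nrmc1 // !exprS nrmcM IH. Qed.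

Lemma nrmc_real (x : R) : nrm x%:C = `|x|.
Proof. by rewrite /nrm normc_def /= expr0n addr0 sqrtr_sqr. Qed.

Lemma nrmc_nat n : nrm (n%:R : R[i]) = n%:R.
Proof. by rewrite -(rmorph_nat (real_complex R)) nrmc_real ger0_norm. Qed.

Lemma conjci : conjc 'i%C = - 'i%C :> R[i].
Proof. by apply/eqP; rewrite eq_complex /= oppr0 !eqxx. Qed.

Lemma imaginaryE (x : R) : 0 +i* x = 'i%C * x%:C :> R[i].
Proof.
by apply/eqP; rewrite eq_complex /=; apply/andP; split; apply/eqP; ring.
Qed.

Lemma nrmc_def (z : R[i]) :
  nrm z = Num.sqrt (complex.Re z ^+ 2 + complex.Im z ^+ 2).
Proof. by rewrite /nrm normc_def. Qed.

Lemma nrmc_sqr (z : R[i]) : nrm z ^+ 2 = complex.Re z ^+ 2 + complex.Im z ^+ 2.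
Proof. by rewrite nrmc_def sqr_sqrtr // addr_ge0 ?sqr_ge0. Qed.

Lemma nrmci : nrm ('i%C : R[i]) = 1.
Proof. by rewrite nrmc_def /= expr0n /= add0r expr1n sqrtr1. Qed.

End RealNorm.

(** * Closed sets and limits in terms of real norms *)

Section ClosedNrm.
Context {R : realType} {V : normedModType R[i]}.

Lemma closed_nrmP (D : set V) :
  closed D <->
  forall x, (forall e : R, 0 < e -> exists2 y, D y & nrm (x - y) < e) -> D x.
Proof.
split=> [cD x hx|H].
  apply: cD => B /nbhs_ballP[e /= e0 eB].
  have eR : e = (complex.Re e)%:C by rewrite RRe_real // gtr0_real.
  have [|y Dy xy] := hx (complex.Re e); first by rewrite -ltcR -eR.
  exists y; split=> //; apply: eB.
  by rewrite -ball_normE /ball_ /= nrmE eR ltcR.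
move=> x clx; apply: H => e e0.
have [|y [Dy]] := clx (ball x e%:C).
  by apply: nbhsx_ballx; rewrite ltcR.
by rewrite -ball_normE /ball_ /= nrmE ltcR => xy; exists y.
Qed.

Lemma cvg_nrmP (u : nat -> V) (l : V) :
  u @ \oo --> l <->
  forall e : R, 0 < e -> exists N, forall n, (N <= n)%N -> nrm (l - u n) < e.
Proof.
split=> [/cvgrPdist_lt ul e e0|H].
  have [|N _ HN] := ul e%:C; first by rewrite ltcR.
  by exists N => n Nn; rewrite -ltcR -nrmE; exact: HN.
apply/cvgrPdist_lt => e e0.
have eR : e = (complex.Re e)%:C by rewrite RRe_real // gtr0_real.
have [|N HN] := H (complex.Re e); first by rewrite -ltcR -eR.
by exists N => // n /= Nn; rewrite nrmE eR ltcR; exact: HN.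
Qed.

End ClosedNrm.

Section EpsilonTopology.
Context {R : realType} {V : normedModType R[i]}.

Lemma closed_lipschitz_preimage (W : normedModType R[i]) (f : V -> W) (C : R)
    (D : set W) :
  (forall x y, nrm (f x - f y) <= C * nrm (x - y)) -> closed D ->
  closed [set x | D (f x)].
Proof.
move=> fC /(proj1 (closed_nrmP D)) cD; apply/(proj2 (closed_nrmP _)) => x hx.
apply: (cD (f x)) => e e0.
have C1 : 0 < `|C| + 1 by rewrite ltr_wpDl.
have [|y Dy xy] := hx (e / (`|C| + 1)); first by rewrite divr_gt0.
exists (f y) => //; apply: le_lt_trans (fC _ _) _.
move: xy; rewrite ltr_pdivlMr // => xy; apply: le_lt_trans xy.
rewrite mulrC ler_wpM2l ?nrm_ge0 // (le_trans (ler_norm C)) //.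
by rewrite lerDl.
Qed.

(** The passages to the limit below mostly take this form: the relation in question is the zero set
    of a Lipschitz map. *)
Lemma closed_eq0 (W : normedModType R[i]) (f : V -> W) (C : R) :
  (forall x y, nrm (f x - f y) <= C * nrm (x - y)) -> closed [set x | f x = 0].
Proof.
move=> fC; apply: (@closed_lipschitz_preimage _ _ _ [set 0] fC).
apply/(proj2 (closed_nrmP _)) => x hx /=; apply/eqP; rewrite -nrm_eq0 eq_le nrm_ge0 andbT.
apply/ler_addgt0Pr => e e0; rewrite add0r.
by have [y -> ] := hx e e0; rewrite subr0 => /ltW.
Qed.

End EpsilonTopology.

(** * Elementary C*-algebra *)

Section CstarNorm.
Context {R : realType} {A : cstarAlgType R}.
Implicit Types x y : A.

Lemma cmul0l x : 0 ** x = 0 :> A.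
Proof. by rewrite -{1}(scale0r x) cmulZl scale0r. Qed.

Lemma cmul0r x : x ** 0 = 0 :> A.
Proof. by rewrite -{1}(scale0r x) cmulZr scale0r. Qed.

Lemma cmulNl x y : (- x) ** y = - (x ** y).
Proof. by rewrite -scaleN1r cmulZl scaleN1r. Qed.

Lemma cmulNr x y : x ** (- y) = - (x ** y).
Proof. by rewrite -scaleN1r cmulZr scaleN1r. Qed.

Lemma cmulBl x y z : (x - y) ** z = x ** z - y ** z.
Proof. by rewrite cmulDl cmulNl. Qed.

Lemma cmulBr x y z : z ** (x - y) = z ** x - z ** y.
Proof. by rewrite cmulDr cmulNr. Qed.

Lemma cmul_suml I (s : seq I) (P : pred I) (F : I -> A) x :
  (\sum_(i <- s | P i) F i) ** x = \sum_(i <- s | P i) F i ** x.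
Proof.
exact: (big_morph (cmul^~ x) (fun y z => cmulDl y z x) (cmul0l x)).
Qed.

Lemma cmul_sumr I (s : seq I) (P : pred I) (F : I -> A) x :
  x ** (\sum_(i <- s | P i) F i) = \sum_(i <- s | P i) x ** F i.
Proof.
exact: (big_morph (cmul x) (fun y z => cmulDr x y z) (cmul0r x)).
Qed.

Lemma star0 : star 0 = 0 :> A.
Proof. by rewrite -{1}(scale0r 0) starZ conjc0 scale0r. Qed.

Lemma starN x : star (- x) = - star x.
Proof. by rewrite -scaleN1r starZ rmorphN1 scaleN1r. Qed.

Lemma starB x y : star (x - y) = star x - star y.
Proof. by rewrite starD starN. Qed.

Lemma star_sum I (s : seq I) (P : pred I) (F : I -> A) :
  star (\sum_(i <- s | P i) F i) = \sum_(i <- s | P i) star (F i).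
Proof. exact: (big_morph star (@starD _ _) star0). Qed.

Lemma nrmM x y : nrm (x ** y) <= nrm x * nrm y.
Proof. by rewrite -lecR rmorphM /= -!nrmE cmul_norm. Qed.

Lemma nrm_cstar x : nrm (star x ** x) = nrm x ^+ 2.
Proof. by apply: complexI; rewrite rmorphXn /= -!nrmE cstar_norm. Qed.

Lemma nrm_star x : nrm (star x) = nrm x.
Proof.
have H y : nrm y <= nrm (star y).
  have [y0|y0] := leP (nrm y) 0; first exact: le_trans y0 (nrm_ge0 _).
  by rewrite -(ler_pM2r y0) -expr2 -nrm_cstar nrmM.
by apply/eqP; rewrite eq_le H andbT -{2}[x]starK H.
Qed.

Lemma cstar_eq0 x : star x ** x = 0 -> x = 0.
Proof.
move=> xx; apply/eqP; rewrite -nrm_eq0 -sqrf_eq0 -nrm_cstar xx.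
by rewrite nrm0.
Qed.

Lemma nrm_proj x : is_projection x -> nrm x <= 1.
Proof.
move=> [sx xx]; have := nrm_cstar x; rewrite sx xx => h.
have [x0|x0] := leP (nrm x) 0; first exact: le_trans x0 _.
by rewrite -(ler_pM2r x0) mul1r -expr2 -h.
Qed.

End CstarNorm.

(** * The algebraic unitization and its action *)

(* Only the algebra structure is put on [R[i] * A]; the operator norm enters
   through the predicate [contractive]. *)
Definition unitization (R : realType) (A : cstarAlgType R) : Type :=
  (R[i] * A)%type.

Section Unitization.
Context {R : realType} {A : cstarAlgType R}.
Local Notation U := (unitization A).

HB.instance Definition _ := GRing.Lmodule.copy U (R[i]^o * A)%type.

Definition unit_mul (u v : U) : U :=
  (u.1 * v.1, u.1 *: v.2 + v.1 *: u.2 + u.2 ** v.2).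

Lemma unit_mulA : associative unit_mul.
Proof.
move=> [a x] [b y] [c z]; rewrite /unit_mul /=; congr pair; first exact: mulrA.
rewrite !scalerDr !cmulDl !cmulDr !cmulZl !cmulZr !scalerA cmulA.
rewrite (mulrC c a) (mulrC c b).
by rewrite [LHS](AC (4*3) (1*2*4*6*(3*5*7))) [RHS](AC (1*3*3) (1*2*3*4*(5*6*7))).
Qed.

Lemma unit_mul1 : left_id ((1, 0) : U) unit_mul.
Proof.
by move=> [a x]; rewrite /unit_mul /= mul1r scale1r scaler0 cmul0l !addr0.
Qed.

Lemma unit_mulr1 : right_id ((1, 0) : U) unit_mul.
Proof.
move=> [a x]; rewrite /unit_mul /= mulr1 scale1r scaler0 cmul0r add0r.
by rewrite addr0.
Qed.

Lemma unit_mulDl : left_distributive unit_mul +%R.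
Proof.
move=> [a x] [b y] [c z]; rewrite /unit_mul /= mulrDl; congr pair.
by rewrite !scalerDl scalerDr cmulDl; rewrite [LHS](AC (2*2*2) ((1*3*5)*(2*4*6))).
Qed.

Lemma unit_mulDr : right_distributive unit_mul +%R.
Proof.
move=> [a x] [b y] [c z]; rewrite /unit_mul /= mulrDr; congr pair.
by rewrite !scalerDl scalerDr cmulDr; rewrite [LHS](AC (2*2*2) ((1*3*5)*(2*4*6))).
Qed.

Lemma unit_oner_neq0 : ((1, 0) : U) != 0.
Proof. by rewrite xpair_eqE negb_and oner_eq0. Qed.

HB.instance Definition _ := GRing.Zmodule_isNzRing.Build U
  unit_mulA unit_mul1 unit_mulr1 unit_mulDl unit_mulDr unit_oner_neq0.

Lemma unit_scaleAl (k : R[i]) (u v : U) : k *: (u * v) = (k *: u) * v.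
Proof.
congr pair; first exact: mulrA.
by rewrite /= !scalerDr !scalerA cmulZl (mulrC k v.1).
Qed.

HB.instance Definition _ := GRing.Lmodule_isLalgebra.Build R[i] U unit_scaleAl.

Lemma unit_scaleAr (k : R[i]) (u v : U) : k *: (u * v) = u * (k *: v).
Proof.
congr pair; first exact: mulrCA.
by rewrite /= !scalerDr !scalerA cmulZr (mulrC u.1 k).
Qed.

HB.instance Definition _ := GRing.Lalgebra_isAlgebra.Build R[i] U unit_scaleAr.

Definition ustar (u : U) : U := (conjc u.1, star u.2).
Definition inU (x : A) : U := (0, x).
(** Left multiplication on the ideal A. When A has a unit e, the element (1, -e) acts as 0, so
    statements about the action concern operators on A. *)
Definition act (u : U) (b : A) : A := u.1 *: b + u.2 ** b.

Lemma inUM x y : inU (x ** y) = inU x * inU y.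
Proof. by congr pair; rewrite /= ?mul0r // !scale0r !add0r. Qed.

Lemma inUD x y : inU (x + y) = inU x + inU y.
Proof. by congr pair; rewrite /= addr0. Qed.

Lemma inUN x : inU (- x) = - inU x.
Proof. by congr pair; rewrite /= oppr0. Qed.

Lemma inUZ (k : R[i]) x : inU (k *: x) = k *: inU x.
Proof. by congr pair; rewrite /= scaler0. Qed.

Lemma ustarD u v : ustar (u + v) = ustar u + ustar v.
Proof. by congr pair; rewrite /= ?starD // rmorphD. Qed.

Lemma ustarZ (k : R[i]) u : ustar (k *: u) = conjc k *: ustar u.
Proof. by congr pair; rewrite /= ?starZ // rmorphM. Qed.

Lemma ustarN u : ustar (- u) = - ustar u.
Proof. by congr pair; rewrite /= ?starN // rmorphN. Qed.

Lemma ustar1 : ustar 1 = 1.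
Proof. by rewrite /ustar conjc1 star0. Qed.

Lemma ustarK : involutive ustar.
Proof. by move=> [a x]; rewrite /ustar /= starK conjcK. Qed.

Lemma ustar_inU x : ustar (inU x) = inU (star x).
Proof. by rewrite /ustar conjc0. Qed.

Lemma act1 b : act 1 b = b.
Proof. by rewrite /act /= scale1r cmul0l addr0. Qed.

Lemma actD u v b : act (u + v) b = act u b + act v b.
Proof. by rewrite /act /= scalerDl cmulDl addrACA. Qed.

Lemma actZ (k : R[i]) u b : act (k *: u) b = k *: act u b.
Proof. by rewrite /act /= scalerDr scalerA cmulZl. Qed.

Lemma actN u b : act (- u) b = - act u b.
Proof. by rewrite -scaleN1r actZ scaleN1r. Qed.

Lemma actM u v b : act (u * v) b = act u (act v b).
Proof.
rewrite /act /= !scalerDr !cmulDl !cmulDr !scalerA !cmulZl !cmulZr cmulA.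
rewrite -!addrA; congr (_ + _).
Qed.

Lemma act_inU x b : act (inU x) b = x ** b.
Proof. by rewrite /act /= scale0r add0r. Qed.

Lemma star_act u b c : star (act u b) ** c = star b ** act (ustar u) c.
Proof.
rewrite /act /= starD starZ starM cmulDl cmulDr cmulZl cmulZr.
by rewrite cmulA.
Qed.

(** For self-adjoint h of norm at most 2, [contractive (1 + inU h)] amounts to h <= 0; signs are
    expressed in this way. *)
Definition contractive (u : U) : Prop := forall b, nrm (act u b) <= nrm b.

Lemma contractive1 : contractive 1.
Proof. by move=> b; rewrite act1. Qed.

Lemma contractiveM u v : contractive u -> contractive v -> contractive (u * v).
Proof. by move=> cu cv b; rewrite actM (le_trans (cu _)). Qed.

Lemma contractive_conv (s t : R) u v : 0 <= s -> 0 <= t -> s + t = 1 ->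
  contractive u -> contractive v -> contractive (s%:C *: u + t%:C *: v).
Proof.
move=> s0 t0 st cu cv b; rewrite actD !actZ (le_trans (nrmD _ _)) //.
rewrite !nrmZ !nrmc_real !ger0_norm // -[leRHS]mul1r -st mulrDl.
by apply: lerD; rewrite ler_wpM2l.
Qed.

(** The C*-identity for operators: |ub|^2 is the norm of b^* times u^* u b. Contractivity thus
    passes from u^* u to u and from u to u^* . *)
Lemma nrm_act_sqr u b :
  nrm (act u b) ^+ 2 <= nrm b * nrm (act (ustar u * u) b).
Proof. by rewrite -nrm_cstar star_act -actM (le_trans (nrmM _ _)) // nrm_star. Qed.

Lemma contractive_sqr u : contractive (ustar u * u) -> contractive u.
Proof.
move=> cu b; rewrite -(@ler_pXn2r _ 2) ?nnegrE ?nrm_ge0 //.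
by rewrite (le_trans (nrm_act_sqr _ _)) // expr2 ler_wpM2l ?nrm_ge0.
Qed.

Lemma contractive_star u : contractive u -> contractive (ustar u).
Proof.
move=> cu b; set c := act (ustar u) b.
have [c0|c0] := leP (nrm c) 0; first exact: le_trans c0 (nrm_ge0 _).
rewrite -(ler_pM2r c0) -expr2 (le_trans (nrm_act_sqr _ _)) // ustarK actM.
by rewrite ler_wpM2l ?nrm_ge0.
Qed.

Lemma contractive_scale (t : R) u : 0 <= t <= 1 -> contractive (1 + u) ->
  contractive (1 + t%:C *: u).
Proof.
move=> /andP[t0 t1] cu.
have -> : 1 + t%:C *: u = (1 - t)%:C *: 1 + t%:C *: (1 + u).
  by rewrite scalerDr addrA -scalerDl -rmorphD subrK scale1r.
by apply: contractive_conv; rewrite ?subr_ge0 ?subrK //; exact: contractive1.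
Qed.

End Unitization.

(** * Square roots and the absence of negative squares *)

Lemma geometric_small (R : realType) (C q e : R) : 0 <= q < 1 -> 0 < e ->
  exists N, forall n, (N <= n)%N -> C * q ^+ n < e.
Proof.
move=> /andP[q0 q1] e0.
have /cvgrPdist_lt/(_ _ e0)[N _ HN] : geometric C q @ \oo --> 0.
  by apply: cvg_geometric; rewrite ger0_norm.
exists N => n Nn; apply: le_lt_trans (HN n Nn).
by rewrite /= sub0r normrN ler_norm.
Qed.

Lemma nrm_cauchy_cvg (R : realType) (V : completeNormedModType R[i])
    (u : nat -> V) :
  (forall e : R, 0 < e -> exists N, forall n m, (N <= n)%N ->
     nrm (u n - u (n + m)%N) < e) ->
  exists l : V, u @ \oo --> l.
Proof.
move=> H; suff cu : cvgn u by exists (limn u).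
apply/cauchy_cvgP/cauchy_exP => e e0.
have eR : e = (complex.Re e)%:C by rewrite RRe_real // gtr0_real.
have [|N HN] := H (complex.Re e); first by rewrite -ltcR -eR.
exists (u N), N => // n /= Nn.
by rewrite -ball_normE /ball_ /= nrmE eR ltcR -(subnKC Nn) HN.
Qed.

Lemma nrm_geometric_cvg (R : realType) (V : completeNormedModType R[i])
    (u : nat -> V) (C q : R) : 0 <= q < 1 ->
  (forall n, nrm (u n - u n.+1) <= C * q ^+ n) -> exists l : V, u @ \oo --> l.
Proof.
move=> /andP[q0 q1] uC; apply: nrm_cauchy_cvg => e e0.
have q1' : 0 < 1 - q by rewrite subr_gt0.
have C0 : 0 <= C by have := le_trans (nrm_ge0 _) (uC 0%N); rewrite expr0 mulr1.
have H n m : nrm (u n - u (n + m)%N) <= C / (1 - q) * (q ^+ n - q ^+ (n + m)).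
  elim: m => [|m IH]; first by rewrite addn0 !subrr nrm0 mulr0.
  apply: le_trans (nrm_distD (u (n + m)%N) _ _) _.
  rewrite addnS; apply: le_trans (lerD IH (uC _)) _.
  rewrite exprS le_eqVlt; apply/orP; left; apply/eqP.
  by field; rewrite lt0r_neq0.
have [|N HN] := geometric_small (C / (1 - q)) (q := q) _ e0.
  by rewrite q0.
exists N => n m Nn; apply: le_lt_trans (H n m) (le_lt_trans _ (HN n Nn)).
apply: ler_wpM2l; first by rewrite divr_ge0 // ltW.
by rewrite lerBlDr lerDl exprn_ge0.
Qed.

Section SquareRoot.
Context {R : realType} {A : cstarAlgType R}.
Implicit Types x y z : A.

(* In the unitization the conclusion reads (1 - y) ^+ 2 = 1 - x: [y] is the
   fixed point of a contraction of the ball of radius [nrm x]. *)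
Lemma quasi_sqrt x : star x = x -> nrm x < 1 ->
  exists y, [/\ star y = y, y + y = x + y ** y &
    forall z, z ** x = x ** z -> z ** y = y ** z].
Proof.
move=> sx x1; set q := nrm x.
have q0 : 0 <= q := nrm_ge0 x.
pose h : R[i] := (2^-1 : R)%:C.
have hh : h + h = 1.
  rewrite -rmorphD -[RHS](rmorph1 (real_complex R)); congr _%:C.
  by field.
have nh : nrm h = 2^-1 by rewrite nrmc_real ger0_norm // invr_ge0.
pose f y := h *: (x + y ** y).
have fL y z : nrm y <= q -> nrm z <= q -> nrm (f y - f z) <= q * nrm (y - z).
  move=> yq zq; rewrite -scalerBr nrmZ nh.
  (* This factorization holds without commutation; the factor 1/2 compensates for its two terms and
     leaves the constant q < 1. *)
  have -> : x + y ** y - (x + z ** z) = y ** (y - z) + (y - z) ** z.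
    by rewrite cmulBl cmulBr opprD addrACA subrr add0r addrA subrK.
  rewrite ler_pdivrMl //; apply: le_trans (nrmD _ _) _.
  apply: le_trans (lerD (nrmM _ _) (nrmM _ _)) _.
  have := nrm_ge0 (y - z); nra.
have fB y : nrm y <= q -> nrm (f y) <= q.
  move=> yq; rewrite nrmZ nh ler_pdivrMl //.
  apply: le_trans (nrmD _ _) _; apply: le_trans (lerD (lexx _) (nrmM _ _)) _.
  rewrite -/q; have := nrm_ge0 y; nra.
pose u n := iter n f 0.
have uB n : nrm (u n) <= q.
  by elim: n => [|n IH]; [rewrite nrm0|exact: fB].
have [||y uy] := @nrm_geometric_cvg _ _ u (nrm (u 0%N - u 1%N)) q.
- by rewrite q0.
- elim=> [|n IH]; first by rewrite expr0 mulr1.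
  apply: (@le_trans _ _ (q * nrm (u n - u n.+1))); first exact: (fL _ _ (uB n) (uB n.+1)).
  by rewrite exprS mulrCA ler_wpM2l.
(* Closed conditions pass from the iterates to the limit; self-adjointness and commutation are
   obtained in this way. *)
have clu (D : set A) : closed D -> (forall n, D (u n)) -> D y.
  move=> /closed_nrmP cD Du; apply: cD => e e0.
  by have [N HN] := (cvg_nrmP _ _).1 uy e e0; exists (u N) => //; exact: HN.
have yB : nrm y <= q.
  apply/ler_addgt0Pr => e e0; have [N /(_ N (leqnn N)) HN] := (cvg_nrmP _ _).1 uy e e0.
  rewrite -(subrK (u N) y) addrC (le_trans (nrmD _ _)) // lerD // ltW //.
have yf : y = f y.
  apply/eqP; rewrite -subr_eq0 -nrm_eq0 eq_le nrm_ge0 andbT.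
  apply/ler_addgt0Pr => e e0; rewrite add0r.
  have [|N HN] := (cvg_nrmP _ _).1 uy (e / 2); first by rewrite divr_gt0.
  rewrite (le_trans (nrm_distD (u N.+1) _ _)) // (splitr e) lerD //.
    by rewrite ltW // HN.
  rewrite (le_trans (fL _ _ (uB _) yB)) // nrmBC ltW //.
  have := HN N (leqnn N); have := nrm_ge0 (y - u N).
  by move=> a b; apply: le_lt_trans b; rewrite -[leRHS]mul1r ler_wpM2r // ltW.
exists y; split.
- apply/eqP; rewrite -subr_eq0; apply/eqP.
  move: y {yB yf uy} clu => y /(_ [set y | star y - y = 0]); apply.
    apply: (@closed_eq0 _ _ _ _ 2) => a b.
    rewrite opprD addrACA -opprD -starB.
    by rewrite (le_trans (nrmB _ _)) // nrm_star mulr_natl mulr2n.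
  elim=> [|n IH]; first by rewrite /= star0 subrr.
  move/eqP: IH; rewrite subr_eq0 => /eqP IH.
  by rewrite /= /f starZ conjc_real starD sx starM IH subrr.
- by rewrite {1 2}yf -scalerDl hh scale1r.
- move=> z zx; apply/eqP; rewrite -subr_eq0; apply/eqP.
  move: y {yB yf uy} clu => y /(_ [set y | z ** y - y ** z = 0]); apply.
    apply: (@closed_eq0 _ _ _ _ (2 * nrm z)) => a b.
    rewrite opprD addrACA -opprD -cmulBr -cmulBl.
    apply: le_trans (nrmB _ _) _; apply: le_trans (lerD (nrmM _ _) (nrmM _ _)) _.
    by rewrite (mulrC (nrm (a - b))) -mulrA mulr_natl mulr2n.
  elim=> [|n IH]; first by rewrite /= cmul0l cmul0r subrr.
  move/eqP: IH; rewrite subr_eq0 => /eqP IH.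
  by rewrite /= /f cmulZl cmulZr cmulDl cmulDr zx cmulA IH -!cmulA IH subrr.
Qed.

End SquareRoot.

Section NegativeSquares.
Context {R : realType} {A : cstarAlgType R}.
Local Notation U := (unitization A).
Implicit Types (x y k w : A) (u v : U).

Let half : R[i] := (2^-1 : R)%:C.

Lemma half_double : half + half = 1.
Proof.
rewrite -rmorphD -[RHS](rmorph1 (real_complex R)); congr _%:C.
by field.
Qed.

Lemma contractive_mid u v : contractive u -> contractive v ->
  contractive (half *: u + half *: v).
Proof.
apply: contractive_conv; rewrite ?invr_ge0 //.
by field.
Qed.

Lemma ustar_mul_cartesian (u v : U) : ustar u = u -> ustar v = v -> u * v = v * u ->
  ustar (u + 'i%C *: v) * (u + 'i%C *: v) = u * u + v * v.
Proof.
move=> su sv uv; rewrite ustarD ustarZ su sv.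
rewrite conjci mulrDl !mulrDr -!scalerAl -!scalerAr uv scalerA.
have -> : - 'i%C * 'i%C = 1 :> R[i] by rewrite mulNr -expr2 sqr_i opprK.
by rewrite scale1r scaleNr addrA addrK.
Qed.

(** With p = (1 - k^2)^(1/2) from [quasi_sqrt], the element u = p + ik satisfies u^* u = 1. Its real
    part p is the midpoint of u and u^* , hence contractive, and so is p^2. *)
Lemma contractive_1B_sqr k : star k = k -> nrm k < 1 ->
  contractive (1 - inU (k ** k)).
Proof.
move=> sk k1.
have [||y [sy yy cy]] := @quasi_sqrt _ _ (k ** k).
- by rewrite starM sk.
- by have := nrm_cstar k; rewrite sk => ->; rewrite expr_lt1 ?nrm_ge0.
pose p : U := 1 - inU y; pose K := inU k.
have pK : p * K = K * p.
  by rewrite mulrBl mulrBr mul1r mulr1 -!inUM cy // cmulA.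
have pp : p * p = 1 - inU (k ** k).
  have hY : inU y + inU y = inU (k ** k) + inU y * inU y.
    by rewrite -inUD yy inUD -inUM.
  by rewrite mulrBl !mulrBr !mul1r mulr1 -addrA -opprD addrA hY addrK.
have sp : ustar p = p by rewrite ustarD ustarN ustar1 ustar_inU sy.
have sK : ustar K = K by rewrite ustar_inU sk.
have cu : contractive (p + 'i%C *: K).
  apply: contractive_sqr; rewrite ustar_mul_cartesian // pp -inUM subrK.
  exact: contractive1.
have cp : contractive p.
  have := contractive_mid cu (contractive_star cu).
  suff -> : half *: (p + 'i%C *: K) + half *: ustar (p + 'i%C *: K) = p by [].
  rewrite ustarD ustarZ sp sK -scalerDr addrACA -scalerDl.
  by rewrite conjci subrr scale0r addr0 scalerDr -scalerDl half_double scale1r.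
by rewrite -pp; exact: contractiveM.
Qed.

End NegativeSquares.

(** * Extremality of the unit *)

Lemma sqr_1D (V : nzRingType) (K : V) : (1 + K) * (1 + K) = 1 + (K + K) + K * K.
Proof. by rewrite mulrDl mul1r mulrDr mulr1 !addrA. Qed.

Lemma sqr_1B (V : nzRingType) (K : V) : (1 - K) * (1 - K) = 1 - (K + K) + K * K.
Proof. by rewrite sqr_1D mulrNN opprD. Qed.

Lemma cube_1DZ (F : comNzRingType) (V : algType F) (c : F) (K : V) :
  (1 + c *: K) ^+ 3 = 1 + (c *+ 3) *: K + (c ^+ 2 *+ 3) *: K ^+ 2 + c ^+ 3 *: K ^+ 3.
Proof.
rewrite addrC exprD1n !big_ord_recl big_ord0 /= /bump /= !exprZn !addr0 !addrA.
by rewrite expr0 scale1r !expr1 !mulr1n -!scalerMnl !mulrSr !mulr0n !add0r !addrA.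
Qed.

(** The quadratic terms 3K^2 and -3K^2 cancel, so a mean of cubes of contractions has linear part
    3K/2. That this exceeds K drives the amplification in [contractive_1D_eq0]. *)
Lemma cubic_average (R : realType) (V : algType R[i]) (K : V) :
  let h : R[i] := (2^-1 : R)%:C in
  h *: (1 + K) ^+ 3
    + h *: (h *: (1 + 'i%C *: K) ^+ 3 + h *: (1 - 'i%C *: K) ^+ 3) =
  1 + h *: (K *+ 3 + K ^+ 3).
Proof.
move=> h; have hh : h + h = 1 by exact: half_double.
have i2 : 'i%C * 'i%C = -1 :> R[i] by rewrite -expr2 sqr_i.
have -> : h *: (1 + 'i%C *: K) ^+ 3 + h *: (1 - 'i%C *: K) ^+ 3 =
    1 + (- 3) *: K ^+ 2.
  have c1 : 'i%C *+ 3 + (- 'i%C) *+ 3 = 0 :> R[i] by ring.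
  have c2 : 'i%C ^+ 2 *+ 3 + (- 'i%C) ^+ 2 *+ 3 = (1 + 1) * (- 3) :> R[i].
    by rewrite sqrrN sqr_i; ring.
  have c3 : 'i%C ^+ 3 + (- 'i%C) ^+ 3 = 0 :> R[i] by ring.
  rewrite -scalerDr -scaleNr !cube_1DZ addrACA -scalerDl c3 scale0r addr0.
  rewrite addrACA -scalerDl c2 [X in X + _]addrACA -scalerDl c1 scale0r addr0.
  by rewrite -scalerA scalerDl scale1r addrACA scalerDr -scalerDl hh scale1r.
have -> : 1 + h *: (K *+ 3 + K ^+ 3) = h *: ((1 + 1) + (K *+ 3 + K ^+ 3)).
  by rewrite [RHS]scalerDr [h *: (1 + 1)]scalerDr -scalerDl hh scale1r.
rewrite -{1}[K]scale1r cube_1DZ -scalerDr !expr1n -!scalerMnl !scale1r; congr (h *: _).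
by rewrite scaleNr scaler_nat addrAC [in LHS]addrACA subrr addr0 (addrAC 1) -[LHS]addrA.
Qed.

Section NoNegativeSquares.
Context {R : realType} {A : cstarAlgType R}.
Local Notation U := (unitization A).
Implicit Types (x y k w : A) (u v : U).

Let half : R[i] := (2^-1 : R)%:C.

(** The operator (1 + k)^2 - (1 - k)^2 = 4k is a difference of two contractions; evaluated at k it
    yields 4|k|^2 <= 2|k|. *)
Lemma nrm_half_of_contractive_1D k : star k = k ->
  contractive (1 + inU k) -> contractive (1 - inU k) -> nrm k <= 2^-1.
Proof.
move=> sk cp cm; have [k0|k0] := leP (nrm k) 0.
  by apply: le_trans k0 _; rewrite invr_ge0.
have e : (4 : R[i]) *: (k ** k) =
    act ((1 + inU k) * (1 + inU k)) k - act ((1 - inU k) * (1 - inU k)) k.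
  rewrite -actN -actD -act_inU -actZ; congr (act _ _).
  rewrite sqr_1D sqr_1B opprD addrACA subrr addr0 opprD opprK addrACA subrr add0r.
  by rewrite scaler_nat -!mulr2n -mulrnA.
have : nrm ((4 : R[i]) *: (k ** k)) <= nrm k + nrm k.
  rewrite e (le_trans (nrmB _ _)) // lerD //; exact: contractiveM.
have := nrm_cstar k; rewrite nrmZ sk => ->.
have -> : nrm (4 : R[i]) = 4 by apply: nrmc_nat.
by move=> h; rewrite -(ler_pM2r k0); nra.
Qed.

(** Here 1 is the midpoint of 1 + k and 1 - k. A nonzero k could be enlarged again and again by x
    |-> (3x + x^3)/2, which preserves the hypotheses. *)
Lemma contractive_1D_eq0 k : star k = k ->
  contractive (1 + inU k) -> contractive (1 - inU k) -> k = 0.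
Proof.
move=> sk cp cm.
pose P x := [/\ star x = x, contractive (1 + inU x) & contractive (1 - inU x)].
(* Any such element yields another one whose norm is larger by a factor 11/8,
   although all of them have norm at most 1/2. *)
have step x : P x -> exists2 y, P y & 11 / 8 * nrm x <= nrm y.
  move=> [sx xp xm]; pose y := half *: ((3 : R[i]) *: x + x ** x ** x).
  have xh := nrm_half_of_contractive_1D sx xp xm.
  have cc (c : R[i]) (u : U) : contractive u -> contractive (u ^+ 3).
    by move=> cu; rewrite !exprS expr0 mulr1; do 2 (apply: contractiveM => //).
  (* The midpoint of (1 + x)^2 and (1 - x)^2 is 1 + x^2, which is also u^* u for u = 1 + ix. *)
  have imag : contractive (1 + inU (x ** x)).
    have -> : 1 + inU (x ** x) = half *: ((1 + inU x) * (1 + inU x))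
        + half *: ((1 - inU x) * (1 - inU x)).
      rewrite sqr_1D sqr_1B -scalerDr -inUM [X in _ *: X]addrACA.
      rewrite [1 + _ + (1 - _)]addrACA subrr addr0 addrACA scalerDr -scalerDl.
      by rewrite half_double scale1r.
    by apply: contractive_mid; exact: contractiveM.
  have sX : ustar (inU x) = inU x by rewrite ustar_inU sx.
  have ci : contractive (1 + 'i%C *: inU x).
    apply: contractive_sqr; rewrite ustar_mul_cartesian ?ustar1 ?mul1r ?mulr1 //.
    by rewrite -inUM.
  have ci' : contractive (1 - 'i%C *: inU x).
    have := contractive_star ci; rewrite ustarD ustarZ ustar1 sX.
    by rewrite conjci scaleNr.
  have hy : inU y = half *: (inU x *+ 3 + inU x ^+ 3).
    by rewrite inUZ inUD inUZ !inUM scaler_nat !exprS expr0 mulr1 mulrA.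
  exists y.
    split; first by rewrite /y starZ conjc_real starD starZ !starM sx cmulA conjc_nat.
      rewrite hy -cubic_average; do 2 (apply: contractive_mid; [exact: cc|]); exact: cc.
    rewrite hy.
    have -> : - (half *: (inU x *+ 3 + inU x ^+ 3)) =
        half *: ((- inU x) *+ 3 + (- inU x) ^+ 3).
      by rewrite -scalerN opprD mulNrn exprNn -signr_odd /= expr1 mulN1r.
    rewrite -cubic_average !scalerN opprK; do 2 (apply: contractive_mid; [exact: cc|]); exact: cc.
  (* As |x| <= 1/2, the cubic term is at most |x|/4, and 3|x| <= 2|y| + |x|/4 gives the factor
     11/8. *)
  have : nrm ((3 : R[i]) *: x) <= 2 * nrm y + nrm x ^+ 3.
    have -> : (3 : R[i]) *: x = (2 : R[i]) *: y - x ** x ** x.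
      rewrite /y scalerA; have -> : 2 * half = 1 by rewrite mulr_natl mulr2n half_double.
      by rewrite scale1r addrK.
    rewrite (le_trans (nrmB _ _)) // nrmZ nrmc_nat lerD2l.
    rewrite !exprS expr0 mulr1 mulrA (le_trans (nrmM _ _)) // ler_wpM2r ?nrm_ge0 //.
    exact: nrmM.
  rewrite nrmZ nrmc_nat.
  have := nrm_ge0 x; move: (nrm x) (nrm y) xh => a b; nra.
have iter n : exists2 y, P y & (11 / 8) ^+ n * nrm k <= nrm y.
  elim: n => [|n [y Py ky]]; first by exists k; rewrite ?expr0 ?mul1r.
  have [z Pz yz] := step y Py; exists z => //; apply: le_trans yz.
  by rewrite exprS -mulrA ler_wpM2l.
apply/eqP; rewrite -nrm_eq0 eq_le nrm_ge0 andbT leNgt; apply/negP => k0.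
have [|N HN] := @geometric_small _ 1 (8 / 11) (nrm k) _ k0; first by lra.
have [y [sy yp ym] ky] := iter N.
have := HN N (leqnn N); have := le_trans ky (nrm_half_of_contractive_1D sy yp ym).
have -> : (8 / 11 : R) = (11 / 8)^-1 by lra.
rewrite exprVn; have : 0 < (11 / 8 : R) ^+ N by rewrite exprn_gt0.
move: (_ ^+ N) => a a0; rewrite mul1r => h1 h2.
have : a * a^-1 < a * nrm k by rewrite ltr_pM2l.
by rewrite mulfV ?lt0r_neq0 //; lra.
Qed.

End NoNegativeSquares.

(** Log-convexity makes the ratios of consecutive terms nondecreasing, so a first ratio 1 + d > 1
    forces geometric growth. Bernoulli's inequality applied twice gives a quadratic lower bound for
    a(2n), enough to contradict the linear upper bound. *)
Lemma log_convex_linear_bound (R : realType) (a : nat -> R) (c : R) :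
  (forall n, 0 <= a n) -> (forall n, a n.+1 ^+ 2 <= a n * a n.+2) ->
  (forall n, a n <= a 0%N + n%:R * c) -> a 1%N <= a 0%N.
Proof.
move=> a0 acv alin; rewrite leNgt; apply/negP => a01.
have ap : 0 < a 0%N.
  rewrite lt0r a0 andbT; apply/eqP => a00.
  by move: (acv 0%N) a01; rewrite a00 mul0r => h h1; nra.
pose d := a 1%N / a 0%N - 1.
have d0 : 0 < d by rewrite subr_gt0 ltr_pdivlMr // mul1r.
have step n : 0 < a n /\ (1 + d) * a n <= a n.+1.
  elim: n => [|n [an an1]].
    by split=> //; rewrite /d addrC subrK divfK // lt0r_neq0.
  have an1p : 0 < a n.+1.
    by apply: lt_le_trans an1; rewrite mulr_gt0 // addr_gt0.
  split=> //; rewrite -(ler_pM2l an); apply: le_trans (acv n).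
  by rewrite expr2 mulrA (mulrC (a n)) ler_pM2r.
have lin m n : a m * (1 + n%:R * d) <= a (m + n)%N.
  elim: n => [|n IH]; first by rewrite mul0r addr0 mulr1 addn0.
  have [_ an1] := step (m + n)%N; rewrite addnS; apply: le_trans an1.
  have : a m * 1 <= a (m + n)%N.
    by apply: le_trans IH; rewrite ler_pM2l ?(step m).1 // lerDl mulr_ge0 // ltW.
  by rewrite mulr1 -natr1; move: IH; nra.
have quad n : a 0%N * (n%:R * d) ^+ 2 <= a (n + n)%N.
  apply: le_trans (lin n n); have := lin 0%N n; rewrite add0n.
  have : 0 <= n%:R * d by rewrite mulr_ge0 // ltW.
  by move: (n%:R * d) (a n) => x y; nra.
(* For such n, a(0) n^2 d^2 exceeds n (a(0) + 2|c|), which is at least a(0) + 2nc. *)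
have [n n0 nb] : exists2 n, (0 < n)%N & (a 0%N + 2 * `|c|) / (a 0%N * d ^+ 2) < n%:R.
  exists (Num.truncn ((a 0%N + 2 * `|c|) / (a 0%N * d ^+ 2))).+1 => //.
  exact: truncnS_gt.
have := le_trans (quad n) (alin (n + n)%N).
have n1 : 1 <= n%:R :> R by rewrite ler1n.
move: nb; rewrite ltr_pdivrMr ?mulr_gt0 ?exprn_gt0 // natrD exprMn.
have cc : c <= `|c| := ler_norm c.
have c0 : 0 <= `|c| := normr_ge0 c.
move: (n%:R) n1 => m m1 h1.
rewrite leNgt => /negP; apply.
apply: (@le_lt_trans _ _ (m * (a 0%N + 2 * `|c|))); first by nra.
have m0 : 0 < m by apply: lt_le_trans m1.
by rewrite mulrCA expr2 -!mulrA ltr_pM2l // mulrCA.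
Qed.

(** * Signs of w^* w and of w w^* compared *)

Section KelleyVaught.
Context {R : realType} {A : cstarAlgType R}.
Local Notation U := (unitization A).
Implicit Types (x y k w : A) (u v : U).

Let half : R[i] := (2^-1 : R)%:C.

Lemma half_1D u v : half *: (1 + u) + half *: (1 + v) = 1 + half *: (u + v).
Proof.
by rewrite -scalerDr addrACA scalerDr [half *: (1 + 1)]scalerDr -scalerDl
  half_double scale1r.
Qed.

(* The powers of 1 + w w^* grow at most linearly, because
   (1 + w w^* )^n = 1 + w (sum_(j < n) (1 + w^* w)^j) w^*. *)
Lemma contractive_swap w :
  contractive (1 + inU (star w ** w)) -> contractive (1 + inU (w ** star w)).
Proof.
move=> cw b; set v := 1 + inU (w ** star w).
have sv : ustar v = v by rewrite ustarD ustar1 ustar_inU starM starK.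
pose a n := nrm (act (v ^+ n) b).
have -> : nrm b = a 0%N by rewrite /a expr0 act1.
have -> : nrm (act v b) = a 1%N by rewrite /a expr1.
apply: (@log_convex_linear_bound _ _ (nrm w ^+ 2 * nrm b)).
- by move=> n; exact: nrm_ge0.
(* Since v is self-adjoint, one factor v moves across the product: |v^(n+1) b|^2 is the norm of (v^n
   b)^* times v^(n+2) b. *)
- move=> n; rewrite /a -nrm_cstar exprS actM star_act sv.
  by rewrite -!actM -mulrA -!exprS (le_trans (nrmM _ _)) // nrm_star.
move=> n; rewrite /a expr0 act1.
set u := 1 + inU (star w ** w); pose s n := \sum_(j < n) u ^+ j.
have vE m : v ^+ m = 1 + inU w * s m * inU (star w).
  elim: m => [|m IH]; first by rewrite expr0 /s big_ord0 mulr0 mul0r addr0.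
  have vw : v * inU w = inU w * u.
    by rewrite mulrDl mulrDr mul1r mulr1 -!inUM cmulA.
  rewrite exprS IH mulrDr mulr1 !mulrA vw /s big_ord_recl.
  rewrite [in RHS]mulrDr [in RHS]mulrDl expr0 mulr1 -inUM addrA; congr (_ + _).
  by rewrite -[inU w * u * _]mulrA mulr_sumr; under eq_bigr do rewrite -exprS.
(* A sum of m powers of the contraction u has operator norm at most m; this is the source of the
   linear bound. *)
have sb m c : nrm (act (s m) c) <= m%:R * nrm c.
  elim: m => [|m IH]; first by rewrite /s big_ord0 /act /= scale0r cmul0l addr0 nrm0 mul0r.
  rewrite /s big_ord_recr actD -natr1 mulrDl mul1r (le_trans (nrmD _ _)) // lerD //.
  elim: (m) => [|j IHj]; first by rewrite expr0 act1.
  by rewrite exprS actM; apply: le_trans (cw _) IHj.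
rewrite vE actD act1 !actM !act_inU (le_trans (nrmD _ _)) // lerD2l.
apply: le_trans (nrmM _ _) _.
rewrite mulrCA expr2 -mulrA mulrCA; apply: ler_wpM2l; first exact: nrm_ge0.
apply: le_trans (sb _ _) _; rewrite ler_wpM2l //.
by rewrite (le_trans (nrmM _ _)) // nrm_star.
Qed.

(* With x = w + w^* and y = i (w - w^* ), the element x^2 + y^2 equals
   2 (w^* w + w w^* ); it is nonnegative as a sum of squares, nonpositive by the
   hypothesis and [contractive_swap], hence 0. *)
Lemma starM_neg_sqr_small w k : star k = k -> nrm w < 2^-1 ->
  star w ** w = - (k ** k) -> k = 0.
Proof.
move=> sk w2 wk.
have nwk : nrm w = nrm k.
  apply/eqP; rewrite -(@eqrXn2 _ 2) ?nrm_ge0 // -!nrm_cstar wk nrmN sk.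
  by [].
have k1 : nrm k < 1 by rewrite -nwk; lra.
have cw : contractive (1 + inU (star w ** w)).
  by rewrite wk inUN; exact: contractive_1B_sqr.
have cw' := contractive_swap cw.
pose x := w + star w; pose y := 'i%C *: (w - star w).
have sx : star x = x by rewrite starD starK addrC.
have sy : star y = y.
  by rewrite starZ conjci starB starK scaleNr -scalerN opprB.
have x1 : nrm x < 1.
  by rewrite (le_lt_trans (nrmD _ _)) // nrm_star; lra.
have y1 : nrm y < 1.
  by rewrite nrmZ nrmci mul1r (le_lt_trans (nrmB _ _)) // nrm_star; lra.
have xyE : x ** x + y ** y = (2 : R[i]) *: (star w ** w + w ** star w).
  rewrite cmulZl cmulZr scalerA -expr2 sqr_i scaleN1r /x.
  rewrite !cmulBl !cmulBr !cmulDl !cmulDr !opprB scaler_nat mulr2n.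
  rewrite (addrC (w ** w + _)) (addrC (w ** w)) [LHS]addrACA.
  rewrite [star w ** w + _ + _]addrACA subrr addr0.
  by rewrite [w ** star w + _ + _]addrACA subrr addr0 addrACA.
(* With the factor 1/4, 1 + D is the midpoint of 1 + w^* w and 1 + w w^* , while 1 - D is the
   midpoint of 1 and the mean of 1 - x^2 and 1 - y^2. *)
pose D := (half * half) *: (x ** x + y ** y).
have hh : half + half = 1 by exact: half_double.
have h0 : half != 0 by rewrite (inj_eq (@complexI R) _ 0) invr_neq0.
have sD : star D = D.
  have ch : conjc (half * half) = half * half.
    by rewrite /half -rmorphM; exact: conjc_real.
  by rewrite starZ ch starD !starM sx sy.
have cx := contractive_1B_sqr sx x1; have cy := contractive_1B_sqr sy y1.
have D0 : D = 0.
  apply: contractive_1D_eq0 => //.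
    suff -> : 1 + inU D =
        half *: (1 + inU (star w ** w)) + half *: (1 + inU (w ** star w)).
      exact: contractive_mid.
    rewrite half_1D -inUD -inUZ /D xyE scalerA -mulrA (mulrC half 2) mulr_natl mulr2n hh.
    by rewrite mulr1.
  have h01 : 0 <= (2^-1 : R) <= 1 by apply/andP; split; lra.
  have := contractive_scale h01 (u := - (half *: inU (x ** x + y ** y))).
  rewrite scalerN scalerA /D inUZ; apply.
  suff -> : 1 - half *: inU (x ** x + y ** y) =
      half *: (1 - inU (x ** x)) + half *: (1 - inU (y ** y)).
    exact: contractive_mid.
  by rewrite half_1D -opprD -inUD scalerN.
have xy0 : x ** x + y ** y = 0.
  by move/eqP: D0; rewrite scaler_eq0 mulf_eq0 (negbTE h0) => /eqP.
(* From z^2 = - z'^2, the contraction 1 - z'^2 is 1 + z^2, so extremality applies to z^2. *)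
have sq0 (z z' : A) : star z = z -> star z' = z' -> z ** z + z' ** z' = 0 ->
    contractive (1 - inU (z ** z)) -> contractive (1 - inU (z' ** z')) -> z = 0.
  move=> sz sz' zz cz cz'; apply: cstar_eq0; rewrite sz.
  apply: contractive_1D_eq0 => //; first by rewrite starM sz.
  by rewrite (_ : z ** z = - (z' ** z')) ?inUN //; apply/eqP; rewrite -addr_eq0 zz.
have x0 : x = 0 by exact: (sq0 _ _ sx sy xy0 cx cy).
have y0 : y = 0 by apply: (sq0 _ _ sy sx _ cy cx); rewrite addrC.
have w0 : w = 0.
  have : half *: (x - 'i%C *: y) = 0 by rewrite x0 y0 scaler0 subr0 scaler0.
  rewrite scalerA -expr2 sqr_i scaleN1r opprK addrACA subrr addr0 scalerDr.
  by rewrite -scalerDl hh scale1r.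
apply/eqP; rewrite -nrm_eq0 -nwk w0 nrm0; exact: eqxx.
Qed.

(** Scaling w and k by a real t multiplies both sides by t^2, which reduces the claim to w of small
    norm. *)
Lemma starM_neg_sqr w k : star k = k -> star w ** w = - (k ** k) -> k = 0.
Proof.
move=> sk wk; pose t : R := (3 * (nrm w + 1))^-1.
have w1 : 0 < nrm w + 1 by rewrite ltr_wpDl ?nrm_ge0.
have t0 : 0 < t by rewrite invr_gt0 mulr_gt0.
have ct : conjc t%:C = t%:C := conjc_real t.
have : t%:C *: k = 0.
  apply: (@starM_neg_sqr_small (t%:C *: w)); first by rewrite starZ ct sk.
    rewrite nrmZ nrmc_real gtr0_norm // ltr_pdivrMl ?mulr_gt0 //.
    by have := nrm_ge0 w; lra.
  by rewrite starZ ct !cmulZl !cmulZr wk !scalerN.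
move/eqP; rewrite scaler_eq0 => /orP[|/eqP //].
by rewrite (inj_eq (@complexI R) t 0) gt_eqF.
Qed.

End KelleyVaught.

(** * Relations in a Toeplitz-Cuntz-Krieger family *)

Section Projections.
Context {R : realType} {A : cstarAlgType R}.
Implicit Types (p q : A).

(** Compress p - q = c^* c by x = q - pq. Since px = 0, this gives (cx)^* (cx) = - k^2 with k = qx =
    q - qpq; then k = 0, and x^* x = k. *)
Lemma proj_le_mul p q : is_projection p -> is_projection q -> cle q p ->
  p ** q = q.
Proof.
move=> [sp pp] [sq qq] [c pqc].
pose x := q - p ** q; pose k := q - q ** p ** q.
have px : p ** x = 0 by rewrite cmulBr cmulA pp subrr.
have qx : q ** x = k by rewrite cmulBr qq cmulA.
have sk : star k = k by rewrite starB !starM sp sq cmulA.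
have k0 : k = 0.
  apply: (@starM_neg_sqr _ _ (c ** x)) => //.
  rewrite starM cmulA -(cmulA (star x)) -pqc -cmulA cmulBl px sub0r cmulNr.
  by rewrite -{1}qq -(cmulA q) cmulA qx -{1}sq -starM qx sk.
apply/eqP; rewrite eq_sym -subr_eq0; apply/eqP; apply: cstar_eq0.
by rewrite -/x -k0 -qx starB starM sp sq cmulBl -[q ** p ** x]cmulA px cmul0r subr0.
Qed.

(** Compress p - q1 - q2 by q1 q2: the terms from p and q1 cancel and - (q2 q1 q2)^2 remains, where
    q2 q1 q2 is also (q1 q2)^* (q1 q2). *)
Lemma proj_sum_le_orth p q1 q2 : is_projection p -> is_projection q1 ->
  is_projection q2 -> p ** q1 = q1 -> cle (q1 + q2) p -> q1 ** q2 = 0.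
Proof.
move=> [sp pp] [s1 q11] [s2 q22] pq1 [c pqc].
apply: cstar_eq0; rewrite starM s1 s2 cmulA -(cmulA q2) q11.
have q1p : q1 ** p = q1 by rewrite -[LHS]starK starM sp s1 pq1 s1.
apply: (@starM_neg_sqr _ _ (c ** q1 ** q2)); first by rewrite !starM s1 s2 cmulA.
rewrite !starM s1 s2 -!cmulA (cmulA (star c)) -pqc !cmulA cmulBr.
rewrite cmulDr -[q2 ** q1 ** p]cmulA q1p -[q2 ** q1 ** q1]cmulA q11.
rewrite opprD addrA subrr sub0r !cmulNl; congr (- _).
by rewrite -[in RHS](cmulA (q2 ** q1) q2) q22.
Qed.

End Projections.

Section Families.
Context {R : realType} {E : digraph} {A : cstarAlgType R}.
Context {P : vertex E -> A} {S : edge E -> A}.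

Hypothesis family : is_TCK_family P S.

Lemma family_proj v : is_projection (P v).
Proof. by case: family. Qed.

Lemma family_star v : star (P v) = P v.
Proof. by have [] := family_proj v. Qed.

Lemma family_vertexM v w : P v ** P w = (v == w)%:R *: P v.
Proof.
have [->|vw] := eqVneq v w; first by rewrite scale1r (family_proj w).2.
by rewrite scale0r; case: family => _ [h _]; exact: h.
Qed.

Lemma family_starS e : star (S e) ** S e = P (src e).
Proof. by case: family => _ [_ [_ [h _]]]; exact: h. Qed.

Lemma family_S_src e : S e ** P (src e) = S e.
Proof. by rewrite -family_starS cmulA; case: family => _ [_ [h _]]; exact: h. Qed.

Lemma family_range_proj e : is_projection (S e ** star (S e)).
Proof.
split; first by rewrite starM starK.
by rewrite cmulA -(cmulA (S e)) family_starS family_S_src.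
Qed.

Lemma family_rng_range e : P (rng e) ** (S e ** star (S e)) = S e ** star (S e).
Proof.
apply: proj_le_mul; [exact: family_proj|exact: family_range_proj|].
case: family => _ [_ [_ [_ /(_ (rng e) [set e]%SET)]]]; rewrite big_set1; apply.
by move=> f /set1P ->.
Qed.

Lemma family_rng_S e : P (rng e) ** S e = S e.
Proof.
have <- : S e ** star (S e) ** S e = S e by case: family => _ [_ [h _]]; exact: h.
by rewrite cmulA family_rng_range.
Qed.

(** For distinct ranges the vertex projections separate the two edges; for equal ranges the defining
    inequality is used for F = {e, f}. *)
Lemma family_starS_S e f : star (S e) ** S f = (e == f)%:R *: P (src e).
Proof.
have [->|ef] := eqVneq e f; first by rewrite scale1r family_starS.
rewrite scale0r.
have SQ g : S g ** star (S g) ** S g = S g by case: family => _ [_ [h _]]; exact: h.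
have [re|re] := eqVneq (rng e) (rng f); last first.
  rewrite -(family_rng_S e) -(family_rng_S f) starM family_star cmulA.
  rewrite -(cmulA (star _)) family_vertexM (negbTE re) scale0r.
  by rewrite cmul0r cmul0l.
have orth : S e ** star (S e) ** (S f ** star (S f)) = 0.
  apply: (@proj_sum_le_orth _ _ (P (rng e))); [exact: family_proj
    |exact: family_range_proj|exact: family_range_proj|exact: family_rng_range|].
  case: family => _ [_ [_ [_ /(_ (rng e) [set e; f]%SET)]]].
  rewrite big_setU1 ?big_set1 ?inE //; apply.
  by move=> g /set2P[] ->.
have sQ : star (S e) = star (S e) ** (S e ** star (S e)).
  by rewrite -[in LHS](SQ e) !starM starK.
by rewrite sQ -[S f]SQ cmulA -(cmulA (star (S e))) orth cmul0r cmul0l.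
Qed.

Lemma family_vertex_S v e : P v ** S e = (v == rng e)%:R *: S e.
Proof.
by rewrite -(family_rng_S e) cmulA family_vertexM -cmulZl; case: eqP => [->|_];
  rewrite // !scale0r !cmul0l.
Qed.

(** As there are finitely many vertices, this is the unit of an algebra generated by the family. *)
Definition vertex_sum : A := \sum_v P v.

Lemma vertex_sum_star : star vertex_sum = vertex_sum.
Proof. by rewrite star_sum; apply: eq_bigr => v _; exact: family_star. Qed.

Lemma vertex_sumP v : vertex_sum ** P v = P v.
Proof.
rewrite cmul_suml (bigD1 v) //= family_vertexM eqxx scale1r big1 ?addr0 //.
by move=> w wv; rewrite family_vertexM (negbTE wv) scale0r.
Qed.

Lemma vertex_sum_S e : vertex_sum ** S e = S e.
Proof. by rewrite -(family_rng_S e) cmulA vertex_sumP. Qed.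

Lemma S_vertex_sum e : S e ** vertex_sum = S e.
Proof.
rewrite -{1}(family_S_src e) -cmulA.
have -> : P (src e) ** vertex_sum = P (src e).
  by rewrite -[LHS]starK starM vertex_sum_star family_star vertex_sumP family_star.
exact: family_S_src.
Qed.

End Families.

(** * Products of spanning elements and density of their span *)

Section Paths.
Context {E : digraph}.
Implicit Types (v w : vertex E) (e f : edge E) (es fs : seq (edge E)).

Definition path_end v es := last v (map (@src E) es).

Lemma is_path_rcons v es e :
  is_path v (rcons es e) = is_path v es && (path_end v es == rng e).
Proof.
elim: es v => [|f es IH] v /=; first by rewrite andbT eq_sym.
by rewrite IH andbA.
Qed.

Definition vertex_path v : gpath E :=
  exist (fun x => is_path x.1 x.2) (v, [::]) isT.

Lemma path_srcE (mu : gpath E) : path_src mu = path_end (val mu).1 (val mu).2.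
Proof. by []. Qed.

End Paths.

Section SpanningElements.
Context {R : realType} {E : digraph} {A : cstarAlgType R}.
Context {P : vertex E -> A} {S : edge E -> A}.
Implicit Types (v w : vertex E) (e f : edge E) (es fs : seq (edge E)).

(** A right-nested form of [s_path] closed by the projection at its source, so that vertices are no
    special case and inductions can peel off the first edge. *)
Fixpoint word v es : A := if es is e :: es' then S e ** word (src e) es' else P v.

Hypothesis family : is_TCK_family P S.

Lemma foldl_word a v es : a ** P v = a -> is_path v es ->
  foldl (fun b f => b ** S f) a es = a ** word v es.
Proof.
elim: es a v => [|e es IH] a v av //= /andP[_ pes].
by rewrite (IH _ (src e)) // -cmulA ?(family_S_src family).
Qed.

Lemma s_pathE (mu : gpath E) : s_path P S mu = word (val mu).1 (val mu).2.
Proof.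
case: mu => -[v [|e es]] //= pes; have /andP[_ pes'] := pes.
by rewrite /s_path /= (foldl_word (v := src e)) // (family_S_src family).
Qed.

Lemma vertex_word w v es : is_path v es -> P w ** word v es = (w == v)%:R *: word v es.
Proof.
case: es => [_|e es /= /andP[/eqP <- _]]; last first.
  by rewrite cmulA (family_vertex_S family) cmulZl.
by rewrite (family_vertexM family); case: eqP => [->|_]; rewrite ?scale0r.
Qed.

Lemma word_vertex v es w : word v es ** P w = (path_end v es == w)%:R *: word v es.
Proof.
elim: es v => [|e es IH] v /=; first by rewrite (family_vertexM family).
by rewrite -cmulA IH cmulZr.
Qed.

Lemma word_rcons v es e : is_path v (rcons es e) ->
  word v (rcons es e) = word v es ** S e.
Proof.
elim: es v => [|f es IH] v /=.
  by rewrite andbT => /eqP <-; rewrite (family_S_src family) (family_rng_S family).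
by move=> /andP[_ pes]; rewrite IH // cmulA.
Qed.

Lemma star_word_word v w es fs : is_path v es -> is_path w fs ->
  size es = size fs ->
  star (word v es) ** word w fs =
  ((v, es) == (w, fs))%:R *: P (path_end v es).
Proof.
elim: es v w fs => [|e es IH] v w [|f fs] //=.
  by rewrite (family_star family) (family_vertexM family) xpair_eqE eqxx andbT.
move=> /andP[/eqP re pes] /andP[/eqP rf pfs] [sz].
rewrite -re -rf starM cmulA -(cmulA (star (word _ _))) (family_starS_S family).
rewrite cmulZr cmulZl -cmulA xpair_eqE eqseq_cons.
have [efE|ef] := eqVneq e f; last by rewrite !scale0r andbF scale0r.
move: pes; rewrite efE => pes.
by rewrite eqxx /= scale1r vertex_word // eqxx scale1r IH // xpair_eqE eqxx.
Qed.

Lemma span_eltE (mu nu : gpath E) : span_elt P S mu nu =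
  word (val mu).1 (val mu).2 ** star (word (val nu).1 (val nu).2).
Proof. by rewrite /span_elt !s_pathE. Qed.

Lemma star_span_elt mu nu : star (span_elt P S mu nu) = span_elt P S nu mu.
Proof. by rewrite /span_elt starM starK. Qed.

Lemma span_elt_vertex_path mu :
  span_elt P S mu (vertex_path (path_src mu)) = s_path P S mu.
Proof.
rewrite span_eltE s_pathE /= (family_star family) word_vertex -path_srcE.
by rewrite eqxx scale1r.
Qed.

Lemma span_elt_vertex v : span_elt P S (vertex_path v) (vertex_path v) = P v.
Proof. exact: (span_elt_vertex_path (vertex_path v)). Qed.

Lemma span_elt_mulP mu nu v : span_elt P S mu nu ** P v =
  (v == (val nu).1)%:R *: span_elt P S mu nu.
Proof.
case: nu => -[w es] pes; rewrite !span_eltE /= -cmulA.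
rewrite -[P v](family_star family) -starM vertex_word // starZ conjc_nat.
by rewrite cmulZr.
Qed.

(** One alternative keeps the reason for vanishing, the other the new path; [twisted_edge] uses both
    to match the two sides. *)
Lemma span_elt_mul_starS mu nu e :
  src e <> (val nu).1 /\ span_elt P S mu nu ** star (S e) = 0 \/
  exists nu' : gpath E, [/\ src e = (val nu).1,
    span_elt P S mu nu ** star (S e) = span_elt P S mu nu'
    & val nu' = (rng e, e :: (val nu).2)].
Proof.
case: nu => -[w es] pes; rewrite span_eltE /=.
rewrite -cmulA -starM.
have [we|we] := eqVneq (src e) w; last first.
  left; split; first exact/eqP.
  rewrite -(family_S_src family e) -cmulA vertex_word // (negbTE we).
  by rewrite scale0r cmul0r star0 cmul0r.
have pes' : is_path (rng e, e :: es).1 (rng e, e :: es).2 by rewrite /= eqxx we.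
right; exists (exist (fun x => is_path x.1 x.2) (rng e, e :: es) pes').
by rewrite span_eltE /= we.
Qed.

Lemma span_elt_mulS_vertex mu nu e : (val nu).2 = [::] ->
  span_elt P S mu nu ** S e = 0 \/
  exists mu' : gpath E,
    [/\ span_elt P S mu nu ** S e = span_elt P S mu' (vertex_path (src e))
      & val mu' = ((val mu).1, rcons (val mu).2 e)].
Proof.
case: mu nu => -[v es] pes [[w fs] pfs] /= fs0; subst fs.
rewrite span_eltE /= (family_star family) word_vertex.
have [ew|ew] := eqVneq (path_end v es) w; last first.
  by left; rewrite !(scale0r, cmul0l).
rewrite scale1r.
have [er|er] := eqVneq (path_end v es) (rng e); last first.
  left; rewrite -(family_rng_S family e) cmulA word_vertex (negbTE er).
  by rewrite scale0r cmul0l.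
have pes' : is_path (v, rcons es e).1 (v, rcons es e).2.
  by rewrite /= is_path_rcons er eqxx andbT.
right; exists (exist (fun x => is_path x.1 x.2) (v, rcons es e) pes').
split=> //; rewrite span_eltE /= word_rcons // (family_star family).
by rewrite -cmulA (family_S_src family).
Qed.

Lemma span_elt_mulS_edge mu nu e f fs : (val nu).2 = f :: fs ->
  exists nu' : gpath E,
    [/\ span_elt P S mu nu ** S e = (f == e)%:R *: span_elt P S mu nu'
      & val nu' = (src f, fs)].
Proof.
case: nu => -[w gs] pgs /= gsE; subst gs.
have /andP[_ pfs] : is_path w (f :: fs) := pgs.
exists (exist (fun x => is_path x.1 x.2) (src f, fs) pfs); split=> //.
rewrite !span_eltE /= starM -!cmulA (family_starS_S family) !cmulZr.
rewrite -{1}[P (src f)](family_star family) -starM vertex_word //.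
by rewrite eqxx scale1r.
Qed.

(** The length bound serves ground states: in a product, multiplying by s_ka may shorten the starred
    path to length 0, but s_la^* then prolongs it by |la|. *)
Definition spans (n : nat) (x : A) : Prop :=
  x = 0 \/ exists mu nu, (n <= path_len nu)%N /\ x = span_elt P S mu nu.

Lemma spans_elt mu nu : spans (path_len nu) (span_elt P S mu nu).
Proof. by right; exists mu, nu. Qed.

Lemma spansW n x : spans n x -> spans 0 x.
Proof. by move=> [->|[mu [nu [_ ->]]]]; [left|right; exists mu, nu]. Qed.

Lemma spans_mulP n x v : spans n x -> spans n (x ** P v).
Proof.
move=> [->|[mu [nu [nnu ->]]]]; first by left; rewrite cmul0l.
rewrite span_elt_mulP; case: eqP => _; last by left; rewrite scale0r.
by right; exists mu, nu; rewrite scale1r.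
Qed.

Lemma spans_mulS x e : spans 0 x -> spans 0 (x ** S e).
Proof.
move=> [->|[mu [nu [_ ->]]]]; first by left; rewrite cmul0l.
case nuE : (val nu).2 => [|f fs].
  have [->|[mu' [-> _]]] := span_elt_mulS_vertex mu e nuE; first by left.
  exact: (spansW (spans_elt _ _)).
have [nu' [-> _]] := span_elt_mulS_edge mu e nuE; case: eqP => _.
  by rewrite scale1r; exact: (spansW (spans_elt _ _)).
by left; rewrite scale0r.
Qed.

Lemma spans_mul_starS n x e : spans n x -> spans n.+1 (x ** star (S e)).
Proof.
move=> [->|[mu [nu [nnu ->]]]]; first by left; rewrite cmul0l.
have [[_ ->]|[nu' [_ -> nu'E]]] := span_elt_mul_starS mu nu e; first by left.
by right; exists mu, nu'; split=> //; rewrite /path_len nu'E.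
Qed.

Lemma spans_mul_word x v es : spans 0 x -> spans 0 (x ** word v es).
Proof.
elim: es x v => [|e es IH] x v sx /=; first exact: spans_mulP.
by rewrite cmulA; apply: IH; exact: spans_mulS.
Qed.

Lemma spans_mul_star_word n x v es : spans n x ->
  spans (n + size es) (x ** star (word v es)).
Proof.
elim: es x v => [|e es IH] x v sx /=.
  by rewrite addn0 (family_star family); exact: spans_mulP.
by rewrite starM cmulA addnS; apply: spans_mul_starS; exact: IH.
Qed.

Lemma spans_span_eltM mu nu ka la :
  spans (path_len la) (span_elt P S mu nu ** span_elt P S ka la).
Proof.
rewrite [span_elt _ _ ka la]span_eltE cmulA -[path_len _]add0n.
by apply/spans_mul_star_word/spans_mul_word/(spansW (spans_elt _ _)).
Qed.

Hypothesis generated : cstar_generates (range P `|` range S).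

Lemma nrm_mul_lipschitz_l (x y z : A) :
  nrm (x ** y - x ** z) <= nrm x * nrm (y - z).
Proof. by rewrite -cmulBr nrmM. Qed.

Lemma nrm_mul_lipschitz_r (x y z : A) :
  nrm (y ** x - z ** x) <= nrm x * nrm (y - z).
Proof. by rewrite -cmulBl mulrC nrmM. Qed.

Lemma closed_bigcap_family (V : normedModType R[i]) (F : set (set V)) :
  (forall D, F D -> closed D) -> closed [set x | forall D, F D -> D x].
Proof.
move=> cF; apply/closed_nrmP => x hx D FD.
have /closed_nrmP := cF D FD; apply=> e e0.
by have [y Dy xy] := hx e e0; exists y => //; exact: Dy.
Qed.

(** Both one-sided conditions are imposed at once, since the adjoint exchanges them; their common
    solutions form a C*-subalgebra containing the generators. *)
Lemma vertex_sum_unit x : vertex_sum (P := P) ** x = x /\ x ** vertex_sum (P := P) = x.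
Proof.
set u := vertex_sum.
have su : star u = u := vertex_sum_star family.
have Pu v : P v ** u = P v.
  by rewrite -[LHS]starK starM su (family_star family) (vertex_sumP family)
    (family_star family).
have clos : closed [set b | u ** b - b = 0] /\ closed [set b | b ** u - b = 0].
  split; apply: (@closed_eq0 _ _ _ _ (nrm u + 1)) => y z;
    rewrite opprD addrACA -opprD mulrDl mul1r;
    apply: le_trans (nrmB _ _) _; rewrite lerD //.
    exact: nrm_mul_lipschitz_l.
  exact: nrm_mul_lipschitz_r.
suff h : [set b | u ** b - b = 0] `&` [set b | b ** u - b = 0] = setT.
  have [/eqP + /eqP] : ([set b | u ** b - b = 0] `&` [set b | b ** u - b = 0]) x.
    by rewrite h.
  by rewrite !subr_eq0 => /eqP -> /eqP ->.
apply: generated => [|_ [[v _ <-]|[e _ <-]]]; last 2 first.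
- by split=> /=; rewrite ?(vertex_sumP family) ?Pu subrr.
- by split=> /=; rewrite ?(vertex_sum_S family) ?(S_vertex_sum family) subrr.
have eqE (y z : A) : (y - z = 0) = (y = z).
  by rewrite propeqE; split=> [/eqP|->]; rewrite ?subrr // subr_eq0 => /eqP.
split; first by apply: closedI; [exact: clos.1|exact: clos.2].
- split=> [|k y z [/= + +] [/= + +]]; rewrite /setI /mkset !eqE.
    by rewrite cmul0l cmul0r.
  by move=> h1 h2 h3 h4; rewrite cmulDl cmulDr cmulZl cmulZr h1 h2 h3 h4.
- move=> y z [/= + +] [/= + +]; rewrite /setI /mkset !eqE => h1 h2 h3 h4.
  by rewrite cmulA h1 -cmulA h4.
- move=> y [/= + +]; rewrite /setI /mkset !eqE => h1 h2.
  by rewrite -su -!starM h1 h2.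
Qed.

(** Density of the span, as an induction principle. The smallest closed subspace [D0] containing the
    spanning elements is stable under right multiplication and contains the unit. *)
Lemma closed_subspace_span_elts (D : set A) : closed D -> is_subspace D ->
  span_elts P S `<=` D -> forall x, D x.
Proof.
pose F := [set D : set A | [/\ closed D, is_subspace D & span_elts P S `<=` D]].
move=> cD sD spD; have FD : F D by [].
pose D0 := [set x | forall D, F D -> D x].
have cD0 : closed D0 by apply: closed_bigcap_family => D' [].
have sD0 : is_subspace D0.
  split=> [D' [_ [] //]|k x y Dx Dy D' FD'].
  by have [_ [_ h] _] := FD'; apply: h; [exact: Dx|exact: Dy].
have spanD0 n x : spans n x -> D0 x.
  move=> [->|[mu [nu [_ ->]]] D' [_ _]]; first exact: sD0.1.
  by apply; exists mu, nu.
(* Multiplication by a generator on the right preserves D0; the elements that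
   do so, together with their adjoints, form a C*-subalgebra. *)
pose N := [set b | forall x, D0 x -> D0 (x ** b)].
have NE b : (forall x, spans 0 x -> spans 0 (x ** b)) -> N b.
  move=> hb x Dx D' FD'; have [cD' sD' spD'] := FD'.
  (* This preimage is itself a closed subspace containing the spanning elements, hence it contains
     [D0]. *)
  apply: (Dx [set x | D' (x ** b)]); split.
  - by apply: closed_lipschitz_preimage cD' => y z; exact: nrm_mul_lipschitz_r.
  - split=> [|k y z /= Dy Dz]; first by rewrite /= cmul0l; exact: sD'.1.
    by rewrite cmulDl cmulZl; exact: sD'.2.
  - move=> _ [mu [nu ->]] /=; apply: (spanD0 0%N) FD'.
    by apply: hb; exact: (spansW (spans_elt _ _)).
have cN : closed N.
  apply/closed_nrmP => b hb x Dx; have /closed_nrmP := cD0; apply=> e e0.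
  have x1 : 0 < nrm x + 1 by rewrite ltr_wpDl ?nrm_ge0.
  have [|c Nc bc] := hb (e / (nrm x + 1)); first by rewrite divr_gt0.
  exists (x ** c); first exact: Nc.
  apply: le_lt_trans (nrm_mul_lipschitz_l _ _ _) _.
  move: bc; rewrite ltr_pdivlMr // => bc; apply: le_lt_trans bc.
  by rewrite mulrC ler_wpM2l ?nrm_ge0 // lerDl.
have sN k b c : N b -> N c -> N (k *: b + c).
  move=> Nb Nc x Dx; rewrite cmulDr cmulZr.
  by apply: sD0.2; [exact: Nb|exact: Nc].
have N0 : N 0 by move=> x Dx; rewrite cmul0r; exact: sD0.1.
have NM b c : N b -> N c -> N (b ** c).
  by move=> Nb Nc x Dx; rewrite cmulA; apply: Nc; exact: Nb.
have : [set b | N b /\ N (star b)] = setT.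
  apply: generated => [|_ [[v _ <-]|[e _ <-]]]; last 2 first.
  - by split; rewrite ?(family_star family); apply: NE => x sx; exact: spans_mulP.
  - split; apply: NE => x sx; first exact: spans_mulS.
    by apply: spansW; exact: spans_mul_starS sx.
  split.
  - apply/closed_nrmP => b hb; split; have /closed_nrmP := cN; apply=> e e0.
      by have [y [Ny _] yb] := hb e e0; exists y.
    have [y [_ Ny] yb] := hb e e0; exists (star y) => //.
    by rewrite -starB nrm_star.
  - split=> [|k b c [Nb Nb'] [Nc Nc']]; first by rewrite /= star0.
    by split; [exact: sN|rewrite starD starZ; exact: sN].
  - by move=> b c [Nb Nb'] [Nc Nc']; split; [exact: NM|rewrite starM; exact: NM].
  - by move=> b [Nb Nb'] /=; rewrite starK.
move=> NT x; have [Nx _] : N x /\ N (star x).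
  by rewrite -[_ /\ _]/([set b | N b /\ N (star b)] x) NT.
have D0u : D0 (vertex_sum (P := P)).
  rewrite /vertex_sum; elim/big_ind: _ => [|y z Dy Dz|v _]; first exact: sD0.1.
    by rewrite -[y]scale1r; exact: sD0.2.
  apply: (spanD0 0%N); rewrite -span_elt_vertex; exact: (spansW (spans_elt _ _)).
by rewrite -(vertex_sum_unit x).1; exact: (Nx _ D0u _ FD).
Qed.

End SpanningElements.

(** * Positive functionals *)

Section PositiveFunctionals.
Context {R : realType} {A : cstarAlgType R} {u : A}.

Hypothesis unitP : forall x, u ** x = x /\ x ** u = x.

Let mul1u x : u ** x = x. Proof. exact: (unitP x).1. Qed.
Let mulu1 x : x ** u = x. Proof. exact: (unitP x).2. Qed.

Lemma unit_star : star u = u.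
Proof. by rewrite -{2}[u]starK -[in RHS](mul1u (star u)) starM starK mul1u. Qed.

Lemma nrm_unit : nrm u <= 1.
Proof. by apply: nrm_proj; split; [exact: unit_star|rewrite mul1u]. Qed.

Section OneFunctional.
Context {phi : {scalar A}}.
Hypothesis phi_ge0 : forall c, 0 <= phi (star c ** c).

Let ge0ReIm (z : R[i]) : 0 <= z -> 0 <= complex.Re z /\ complex.Im z = 0.
Proof. by case: z => x y; rewrite lecE /= => /andP[/eqP -> ->]. Qed.

(** The values at the squares of a + u and a + iu are real; their imaginary parts give the two
    components of the identity. *)
Lemma positive_star a : phi (star a) = conjc (phi a).
Proof.
have [_ i0] := ge0ReIm (phi_ge0 a).
have [_ iu] := ge0ReIm (phi_ge0 u).
rewrite unit_star mul1u in iu.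
have [_] := ge0ReIm (phi_ge0 (a + u)).
have [_] := ge0ReIm (phi_ge0 (a + 'i%C *: u)).
rewrite !starD !starZ unit_star conjci !cmulDl !cmulDr !cmulZl !cmulZr !mulu1 !mul1u.
rewrite !linearD !linearZ /=.
case: (phi a) => x y; case: (phi (star a)) => x' y'.
case: (phi u) iu => m1 m2 /= ->.
case: (phi (star a ** a)) i0 => n1 n2 /= ->.
move=> h1 h2; apply/eqP; rewrite eq_complex /=; apply/andP; split; apply/eqP.
  by move: h1; lra.
by move: h2; lra.
Qed.

(** The quasi-square root y of h yields u - h = (u - y)^2. *)
Lemma positive_le_unit h : star h = h -> nrm h < 1 -> 0 <= phi u - phi h.
Proof.
move=> sh h1; have [y [sy yy _]] := quasi_sqrt sh h1.
suff -> : phi u - phi h = phi (star (u - y) ** (u - y)) by [].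
rewrite starB unit_star sy !cmulBl !cmulBr !mul1u mulu1 -linearB; congr (phi _).
by rewrite -[RHS]addrA -opprD addrA yy addrK.
Qed.

Lemma positive_ge0_fine c : phi (star c ** c) = (complex.Re (phi (star c ** c)))%:C.
Proof. by rewrite RRe_real // ger0_real. Qed.

Let m := complex.Re (phi u).

Lemma positive_unit_fine : phi u = m%:C.
Proof. by have := positive_ge0_fine u; rewrite unit_star mul1u. Qed.

Lemma positive_unit_ge0 : 0 <= m.
Proof.
by have := phi_ge0 u; rewrite unit_star mul1u positive_unit_fine lecR.
Qed.

(** Expand phi at the square of a - t phi(a) u and bound phi(a^* a) by phi(u), using the previous
    square root. *)
Lemma positive_nrm_lt1 a : nrm a < 1 -> nrm (phi a) <= m.
Proof.
move=> a1; pose n := nrm (phi a) ^+ 2.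
have h t : 0 <= m - 2 * t * n + t ^+ 2 * n * m.
  have nE : n = complex.Re (phi a) ^+ 2 + complex.Im (phi a) ^+ 2 by exact: nrmc_sqr.
  have := @positive_le_unit (star a ** a).
  rewrite starM starK nrm_cstar expr_lt1 ?nrm_ge0 // => /(_ erefl a1) h1.
  have h2 := phi_ge0 (a - (t%:C * phi a) *: u).
  rewrite starB starZ unit_star !cmulBl !cmulBr !cmulZl !cmulZr mulu1 !mul1u in h2.
  rewrite !linearB /= !linearZ /= positive_star positive_unit_fine in h2.
  move: h1 h2 nE; rewrite (positive_ge0_fine a) positive_unit_fine.
  move: (complex.Re (phi (star a ** a))) (n) => X N; case: (phi a) => x y.
  by rewrite !lecE /= => /andP[_ h1] /andP[_ h2] ->; lra.
have n0 : 0 <= n by rewrite exprn_ge0 ?nrm_ge0.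
rewrite -(@ler_pXn2r _ 2) ?nnegrE ?nrm_ge0 ?positive_unit_ge0 // -/n.
have [m0|m0] := leP m 0.
  have m00 : m = 0 by apply/eqP; rewrite eq_le m0 positive_unit_ge0.
  by have := h 1; rewrite m00; nra.
(* The value t = 1/m minimizes the quadratic in t. *)
have := h m^-1; have -> : m - 2 * m^-1 * n + m^-1 ^+ 2 * n * m = (m ^+ 2 - n) / m.
  by field; rewrite lt0r_neq0.
by rewrite pmulr_lge0 ?invr_gt0 // subr_ge0.
Qed.

Lemma positive_nrm a : nrm (phi a) <= m * nrm a.
Proof.
have H t : nrm a < t -> nrm (phi a) <= m * t.
  move=> at_; have t0 : 0 < t := le_lt_trans (nrm_ge0 _) at_.
  have := @positive_nrm_lt1 (t^-1%:C *: a).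
  rewrite linearZ /= nrmZ nrmcM !nrmc_real gtr0_norm ?invr_gt0 //.
  by rewrite !ler_pdivrMl // ltr_pdivrMl // mulr1 mulrC; exact.
apply/ler_addgt0Pr => e e0.
have m1 : 0 < m + 1 by rewrite ltr_wpDl ?positive_unit_ge0.
have := H (nrm a + e / (m + 1)); rewrite ltrDl divr_gt0 // => /(_ isT) h.
apply: le_trans h _; rewrite mulrDr lerD2l mulrCA ger_pMr //.
by rewrite ler_pdivrMr // mul1r lerDl.
Qed.

(** The degenerate case of Cauchy-Schwarz: as phi(d^* d) = 0, the value at the square of b - t
    phi(d^* b) d is affine in t and nonnegative for every t, so its slope is 0. *)
Lemma positive_mul_eq0 d b : phi (star d ** d) = 0 -> phi (star d ** b) = 0.
Proof.
move=> d0; pose n := nrm (phi (star d ** b)) ^+ 2.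
have h t : 0 <= complex.Re (phi (star b ** b)) - 2 * t * n.
  have nE : n = complex.Re (phi (star d ** b)) ^+ 2 + complex.Im (phi (star d ** b)) ^+ 2.
    exact: nrmc_sqr.
  have h2 := phi_ge0 (b - (t%:C * phi (star d ** b)) *: d).
  rewrite starB starZ !cmulBl !cmulBr !cmulZl !cmulZr in h2.
  have bd : star b ** d = star (star d ** b) by rewrite starM starK.
  rewrite !linearB /= !linearZ /= d0 bd positive_star in h2.
  move: h2 nE; rewrite (positive_ge0_fine b).
  move: (complex.Re (phi (star b ** b))) (n) => X N; case: (phi (star d ** b)) => x y.
  by rewrite !lecE /= => /andP[_ h2] ->; lra.
apply/eqP; rewrite -nrm_eq0 -sqrf_eq0 -/n eq_le exprn_ge0 ?nrm_ge0 // andbT.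
rewrite leNgt; apply/negP => n0.
have := h ((complex.Re (phi (star b ** b)) + 1) / n).
have -> : 2 * ((complex.Re (phi (star b ** b)) + 1) / n) * n =
    2 * (complex.Re (phi (star b ** b)) + 1) by field; rewrite lt0r_neq0.
by have := phi_ge0 b; rewrite positive_ge0_fine lecR; lra.
Qed.

End OneFunctional.
End PositiveFunctionals.

Section FunctionalNorm.
Context {R : realType} {A : cstarAlgType R} {phi : {scalar A}} {C : R}.
Hypotheses (C0 : 0 <= C) (phiC : forall a, nrm (phi a) <= C * nrm a).

Let ball_le a : `|a| <= 1 -> nrm (phi a) <= C.
Proof.
by rewrite nrmE lecR => a1; apply: le_trans (phiC a) _; rewrite ler_piMr.
Qed.

Lemma functional_norm_le : functional_norm phi <= C.
Proof.
apply: ge_sup => [|_ [a /= a1 <-]]; last exact: ball_le.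
by exists (complex.Re `|phi 0|); exists 0 => //=; rewrite normr0.
Qed.

(** The bound by C makes the set of values bounded, which keeps [sup] away from its default value
    0. *)
Lemma functional_norm_ge a : nrm a <= 1 -> nrm (phi a) <= functional_norm phi.
Proof.
move=> a1; apply: ub_le_sup.
  by exists C => _ [b /= b1 <-]; exact: ball_le.
by exists a => //=; rewrite nrmE lecR.
Qed.

End FunctionalNorm.

Section States.
Context {R : realType} {A : cstarAlgType R} {u : A}.
Hypothesis unitP : forall x, u ** x = x /\ x ** u = x.
Context {phi : {scalar A}}.
Hypothesis state_phi : is_state phi.

Lemma state_ge0 c : 0 <= phi (star c ** c).
Proof. by apply: state_phi.1; exists c. Qed.

(** For a positive functional the norm is attained at the unit: the general bound is phi(u) |a|, and
    |u| <= 1. *)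
Lemma state_unit : phi u = 1.
Proof.
have := positive_nrm unitP state_ge0; have := positive_unit_ge0 unitP state_ge0.
rewrite (positive_unit_fine unitP state_ge0).
move: (complex.Re (phi u)) (positive_unit_fine unitP state_ge0) => m mE m0 mb.
have := functional_norm_le m0 mb; have := functional_norm_ge m0 mb (nrm_unit unitP).
rewrite state_phi.2 mE nrmc_real ger0_norm // => m1 m2.
by rewrite (_ : m = 1) //; apply/eqP; rewrite eq_le m1 m2.
Qed.

Lemma state_nrm a : nrm (phi a) <= nrm a.
Proof.
by have := positive_nrm unitP state_ge0 a; rewrite state_unit mul1r.
Qed.

Lemma is_stateP (psi : {scalar A}) : (forall c, 0 <= psi (star c ** c)) ->
  (forall a, nrm (psi a) <= nrm a) -> psi u = 1 -> is_state psi.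
Proof.
move=> psi0 psib psiu; split=> [_ [c ->]|]; first exact: psi0.
have h a : nrm (psi a) <= 1 * nrm a by rewrite mul1r.
apply/eqP; rewrite eq_le functional_norm_le //=.
by have := functional_norm_ge ler01 h (nrm_unit unitP); rewrite psiu nrmc1.
Qed.

End States.

(** * The complex exponential *)

Section ExpSum.
Context {F : numFieldType}.
Implicit Types a b : F.

(** Stated over any numeric field, so that a complex error can be majorized by the same expression
    at real norms. *)
Definition exp_sum a n : F := \sum_(k < n) a ^+ k / k`!%:R.

Lemma exp_sumS a n : exp_sum a n.+1 = exp_sum a n + a ^+ n / n`!%:R.
Proof. by rewrite /exp_sum big_ord_recr. Qed.

Lemma exp_sum_triangle (f : nat -> nat -> F) n :
  \sum_(k < n) \sum_(i < k.+1) f (k - i)%N i =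
  \sum_(i < n) \sum_(j < n - i) f j i.
Proof.
elim: n => [|n IH]; first by rewrite !big_ord0.
rewrite big_ord_recr /= IH [RHS]big_ord_recr /= subSn // subnn.
rewrite [\sum_(j < 1) _]big_ord_recr big_ord0 /= add0r.
rewrite [\sum_(i < n.+1) _]big_ord_recr /= subnn addrA; congr (_ + _).
rewrite -big_split /=; apply: eq_bigr => i _.
by rewrite subSn 1?ltnW // big_ord_recr.
Qed.

(** What is left of the product are the terms with i + j >= n, all with positive coefficients; hence
    the majorization by norms. *)
Lemma exp_sum_mulB a b n : exp_sum a n * exp_sum b n - exp_sum (a + b) n =
  \sum_(i < n) b ^+ i / i`!%:R * (exp_sum a n - exp_sum a (n - i)%N).
Proof.
have -> : exp_sum (a + b) n =
    \sum_(i < n) \sum_(j < n - i) (a ^+ j / j`!%:R * (b ^+ i / i`!%:R)).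
  rewrite -(exp_sum_triangle (fun j i => a ^+ j / j`!%:R * (b ^+ i / i`!%:R))).
  apply: eq_bigr => k _; rewrite exprDn mulr_suml; apply: eq_bigr => i _.
  have ik : (i <= k)%N by rewrite -ltnS.
  have fn0 m : m`!%:R != 0 :> F by rewrite pnatr_eq0 -lt0n fact_gt0.
  rewrite -(bin_fact ik) !natrM -mulr_natl.
  have c0 : 'C(k, i)%:R != 0 :> F by rewrite pnatr_eq0 -lt0n bin_gt0.
  by field; rewrite !fn0 c0.
rewrite [X in _ * X]/exp_sum mulr_sumr -sumrB; apply: eq_bigr => i _.
by rewrite -mulr_suml -mulrBl mulrC.
Qed.

End ExpSum.

Section ComplexExp.
Context {R : realType}.
Implicit Types (x y : R) (z w : R[i]).

Lemma nrm_exp_sumB z m n : (m <= n)%N ->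
  nrm (exp_sum z n - exp_sum z m) <= exp_sum (nrm z) n - exp_sum (nrm z) m.
Proof.
move=> mn; rewrite -(subnKC mn); elim: (n - m)%N => [|k IH].
  by rewrite addn0 !subrr nrm0.
rewrite addnS !exp_sumS ![_ + _ - _]addrAC; apply: le_trans (nrmD _ _) _.
rewrite lerD //.
have e : z ^+ (m + k) / (m + k)`!%:R = z ^+ (m + k) * ((m + k)`!%:R^-1 : R)%:C.
  by rewrite fmorphV /= rmorph_nat.
by rewrite e nrmcM nrmcX nrmc_real ger0_norm // invr_ge0.
Qed.

Lemma nrm_exp_sum_mulB z w n :
  nrm (exp_sum z n * exp_sum w n - exp_sum (z + w) n) <=
  exp_sum (nrm z) n * exp_sum (nrm w) n - exp_sum (nrm z + nrm w) n.
Proof.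
rewrite !exp_sum_mulB; apply: le_trans (nrm_sum _ _ _) _; apply: ler_sum => i _.
rewrite nrmcM; apply: ler_pM; rewrite ?nrm_ge0 //; last exact: nrm_exp_sumB (leq_subr _ _).
have e : w ^+ i / i`!%:R = w ^+ i * (i`!%:R^-1 : R)%:C.
  by rewrite fmorphV /= rmorph_nat.
by rewrite e nrmcM nrmcX nrmc_real ger0_norm // invr_ge0.
Qed.

Lemma cvg_exp_sum_real x : exp_sum x @ \oo --> expR x.
Proof.
have -> : exp_sum x = series (exp_coeff x).
  by apply/funext => n; rewrite /exp_sum /series /= big_mkord.
exact: is_cvg_series_exp_coeff.
Qed.

Lemma cvg_real_complex (f : nat -> R) (l : R) :
  f @ \oo --> l -> (fun n => (f n)%:C : R[i]^o) @ \oo --> (l%:C : R[i]^o).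
Proof.
move=> /cvgrPdist_lt h; apply/cvg_nrmP => e e0.
have [N _ HN] := h e e0; exists N => n Nn.
by rewrite -rmorphB /= nrmc_real; exact: HN.
Qed.

(** Built from real functions, so that on the imaginary axis it is literally the circle parameter of
    the gauge dynamics; its power series is derived from there. *)
Definition cexp z : R[i] :=
  (expR (complex.Re z))%:C * (cos (complex.Im z) +i* sin (complex.Im z)).

Lemma imaginary_pow n : ('i%C : R[i]) ^+ n =
  ((~~ odd n)%:R * (-1) ^ n./2) +i* ((odd n)%:R * (-1) ^+ n.-1./2).
Proof.
have i2 m : ('i%C : R[i]) ^+ m.*2 = ((-1) ^+ m)%:C.
  by rewrite -mul2n exprM sqr_i rmorphXn rmorphN1.
have [on|en] := boolP (odd n); last first.
  rewrite /= mul1r mul0r -[in LHS](odd_double_half n) (negbTE en) add0n i2.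
  by [].
have nE : n = n./2.*2.+1 by rewrite -[LHS]odd_double_half on.
have -> : n.-1./2 = n./2 by rewrite [in LHS]nE /= doubleK.
rewrite mul0r mul1r [in LHS]nE exprS i2.
by apply/eqP; rewrite eq_complex /= !(mul0r, mulr0, mul1r, addr0, subr0) add0r !eqxx.
Qed.

Lemma exp_sum_imaginary y n : exp_sum ('i%C * y%:C) n =
  (series (cos_coeff y) n)%:C + 'i%C * (series (sin_coeff y) n)%:C.
Proof.
rewrite /exp_sum /series /= !big_mkord !rmorph_sum mulr_sumr -big_split /=.
apply: eq_bigr => k _; rewrite exprMn imaginary_pow.
rewrite -mulrA.
have -> : (y%:C ^+ k / k`!%:R : R[i]) = (y ^+ k / k`!%:R)%:C.
  by rewrite rmorphM rmorphXn fmorphV /= rmorph_nat.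
rewrite /cos_coeff /sin_coeff /= -![_ * y ^+ k / _]mulrA; move: (y ^+ k / _) => x.
by apply/eqP; rewrite eq_complex /=; apply/andP; split; apply/eqP; ring.
Qed.

Lemma cvg_exp_sum_imaginary y :
  (exp_sum ('i%C * y%:C) : nat -> R[i]^o) @ \oo --> (cos y +i* sin y : R[i]^o).
Proof.
have -> : cos y +i* sin y = (cos y)%:C + 'i%C * (sin y)%:C :> R[i].
  by rewrite [LHS]complexE.
have -> : exp_sum ('i%C * y%:C) =
    fun n => (series (cos_coeff y) n)%:C + 'i%C * (series (sin_coeff y) n)%:C.
  by apply/funext => n; exact: exp_sum_imaginary.
have cosy : (fun n => (series (cos_coeff y) n)%:C : R[i]^o) @ \oo --> ((cos y)%:C : R[i]^o).
  by apply: cvg_real_complex; rewrite unlock; exact: is_cvg_series_cos_coeff.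
have siny : (fun n => (series (sin_coeff y) n)%:C : R[i]^o) @ \oo --> ((sin y)%:C : R[i]^o).
  by apply: cvg_real_complex; rewrite unlock; exact: is_cvg_series_sin_coeff.
by apply: cvgD cosy _; exact: cvgMr siny.
Qed.

(** Split z into real and imaginary parts a and b. The product of partial sums converges, and its
    distance to the partial sum at a + b is dominated by the same real expression at |a| and |b|,
    which tends to 0. *)
Lemma cvg_exp_sum z : (exp_sum z : nat -> R[i]^o) @ \oo --> (cexp z : R[i]^o).
Proof.
set a : R[i] := (complex.Re z)%:C; set b := 'i%C * (complex.Im z)%:C.
have zE : z = a + b by exact: complexE.
have ca : (exp_sum a : nat -> R[i]^o) @ \oo --> ((expR (complex.Re z))%:C : R[i]^o).
  have -> : (exp_sum a : nat -> R[i]^o) = fun n => (exp_sum (complex.Re z) n)%:C.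
    apply/funext => n; rewrite /exp_sum rmorph_sum; apply: eq_bigr => k _.
    by rewrite rmorphM rmorphXn fmorphV /= rmorph_nat.
  exact: (cvg_real_complex (@cvg_exp_sum_real (complex.Re z))).
have cb : (exp_sum b : nat -> R[i]^o) @ \oo -->
    (cos (complex.Im z) +i* sin (complex.Im z) : R[i]^o).
  exact: cvg_exp_sum_imaginary.
have cab : (fun n => exp_sum a n * exp_sum b n : R[i]^o) @ \oo --> (cexp z : R[i]^o).
  exact: cvgM ca cb.
have err : (fun n => exp_sum (nrm a) n * exp_sum (nrm b) n
    - exp_sum (nrm a + nrm b) n) @ \oo --> (0 : R).
  rewrite -(subrr (expR (nrm a) * expR (nrm b))) -{2}expRD.
  by apply: cvgB; [apply: cvgM|]; exact: cvg_exp_sum_real.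
apply/cvg_nrmP => e e0.
have e2 : 0 < e / 2 by rewrite divr_gt0.
have [N HN] := (cvg_nrmP _ _).1 cab _ e2.
move/cvgrPdist_lt : err => /(_ _ e2)[M _ HM].
exists (maxn N M) => n; rewrite geq_max => /andP[Nn Mn].
rewrite zE; apply: le_lt_trans (nrm_distD (exp_sum a n * exp_sum b n) _ _) _.
rewrite [ltRHS](splitr e) -zE; apply: ltr_leD; first exact: HN.
rewrite zE; apply: le_trans (nrm_exp_sum_mulB _ _ _) _.
by have := HM n Mn; rewrite /= sub0r normrN => /ltW; apply: le_trans; exact: ler_norm.
Qed.

Lemma cexpD z w : cexp (z + w) = cexp z * cexp w.
Proof.
case: z w => [x y] [x' y']; rewrite /cexp /= expRD cosD sinD.
by apply/eqP; rewrite eq_complex /=; apply/andP; split; apply/eqP; ring.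
Qed.

Lemma cexp0 : cexp 0 = 1.
Proof. by rewrite /cexp /= expR0 cos0 sin0 mul1r. Qed.

Lemma nrm_cexp z : nrm (cexp z) = expR (complex.Re z).
Proof.
rewrite /cexp nrmcM nrmc_real ger0_norm ?expR_ge0 // nrmc_def /= cos2Dsin2.
by rewrite sqrtr1 mulr1.
Qed.

Lemma cexp_neq0 z : cexp z != 0.
Proof. by rewrite -nrm_eq0 nrm_cexp gt_eqF // expR_gt0. Qed.

Lemma cexp_real x : cexp x%:C = (expR x)%:C.
Proof. by rewrite /cexp /= cos0 sin0 mulr1. Qed.

Lemma cexp_imaginary x : cexp ('i%C * x%:C) = cos x +i* sin x.
Proof.
by rewrite -imaginaryE /cexp /= expR0 mul1r.
Qed.

Lemma cexpX z n : cexp z ^+ n = cexp (n%:R * z).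
Proof.
elim: n => [|n IH]; first by rewrite mul0r cexp0.
by rewrite exprS IH -cexpD -{1}[z]mul1r -mulrDl nat1r.
Qed.

Lemma cexpN z : cexp (- z) = (cexp z)^-1.
Proof.
apply: (mulfI (cexp_neq0 z)); rewrite -cexpD subrr cexp0 mulfV //.
exact: cexp_neq0.
Qed.

Lemma cexp_int z (d : int) : cexp z ^ d = cexp (d%:~R * z).
Proof.
case: d => n; first by rewrite -exprnP cexpX.
by rewrite NegzE -exprnN cexpX -cexpN mulrNz mulNr.
Qed.

(** The notion [entire] for an arbitrary normed space, so as to cover scalar functions. *)
Definition entire_in (V : normedModType R[i]) (F : R[i] -> V) : Prop :=
  forall z0 : R[i], exists r : R, 0 < r /\ exists c : nat -> V,
    forall z : R[i], `|z - z0| < r%:C ->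
      (fun n : nat => \sum_(k < n) (z - z0) ^+ k *: c k) @ \oo --> F z.

Lemma entire_cexpZ (V : normedModType R[i]) (c : R[i]) (a : V) :
  entire_in (fun z => cexp (c * z) *: a).
Proof.
move=> z0; exists 1; split=> //.
exists (fun k => (cexp (c * z0) * (c ^+ k / k`!%:R)) *: a) => z _.
have h := @cvg_exp_sum (c * (z - z0)).
have {h} h : (fun n => (cexp (c * z0) * exp_sum (c * (z - z0)) n) *: a) @ \oo
    --> (cexp (c * z0) * cexp (c * (z - z0))) *: a.
  by apply: cvgZr_tmp; exact: cvgMr h.
rewrite -cexpD -mulrDr (addrC z0) subrK in h.
suff -> : (fun n => \sum_(k < n)
    (z - z0) ^+ k *: ((cexp (c * z0) * (c ^+ k / k`!%:R)) *: a)) =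
  (fun n => (cexp (c * z0) * exp_sum (c * (z - z0)) n) *: a) by [].
apply/funext => n.
rewrite /exp_sum mulr_sumr scaler_suml; apply: eq_bigr => k _.
by rewrite scalerA exprMn; congr (_ *: _); ring.
Qed.

End ComplexExp.

(** * The identity theorem *)

(** Connectedness of the half-line: P holds at the infimum of the counterexamples, then also on a
    neighbourhood of it, which contains counterexamples. *)
Lemma interval_induction (R : realType) (P : R -> Prop) : P 0 ->
  (forall t, P t -> exists2 d, 0 < d & forall t', `|t' - t| < d -> P t') ->
  (forall t, 0 < t -> (forall t', 0 <= t' < t -> P t') -> P t) ->
  forall t, 0 <= t -> P t.
Proof.
move=> P0 Popen Pclosed t0 t00; apply: contrapT => nP.
pose B := [set t : R | 0 <= t /\ ~ P t].
have hB : has_inf B.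
  by split; [exists t0|exists 0 => b []].
have sP t : 0 <= t < inf B -> P t.
  move=> /andP[t0' ts]; apply: contrapT => nPt.
  have : inf B <= t by apply: ge_inf; [exact: hB.2|].
  by rewrite leNgt ts.
have s0 : 0 <= inf B by apply: lb_le_inf; [exact: hB.1|move=> b []].
have Ps : P (inf B).
  have [<-//|sn0] := eqVneq 0 (inf B).
  by apply: Pclosed => //; rewrite lt_neqAle sn0.
have [d d0 Pd] := Popen _ Ps.
have [b [b0 nPb] bs] := inf_adherent d0 hB.
have sb : inf B <= b by apply: ge_inf; [exact: hB.2|].
apply: nPb; apply: Pd.
by rewrite ger0_norm ?subr_ge0 // ltrBlDl.
Qed.

Section IdentityTheorem.
Context {R : realType}.
Local Notation C := (R[i]^o).

Section PowerSeries.
Context {f : R[i] -> C} {c : nat -> C} {r : R}.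
Hypothesis r0 : 0 < r.
Hypothesis fE : forall w : R[i], nrm w < r ->
  (fun n : nat => \sum_(k < n) w ^+ k *: c k) @ \oo --> f w.

(** A term is the difference of two consecutive partial sums, hence at most 2 once both are within 1
    of the limit. *)
Lemma power_series_bounded (s : R) : 0 < s < r ->
  exists2 M, 0 <= M & forall k, nrm (c k) * s ^+ k <= M.
Proof.
move=> /andP[s0 sr]; pose w : R[i] := s%:C.
have nw : nrm w = s by rewrite nrmc_real gtr0_norm.
have wr : nrm w < r by rewrite nw.
have [N HN] := (cvg_nrmP _ _).1 (fE wr) 1 ltr01.
exists (2 + \sum_(k < N) nrm (c k) * s ^+ k).
  by rewrite addr_ge0 // sumr_ge0 // => k _; rewrite mulr_ge0 ?nrm_ge0 // exprn_ge0 // ltW.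
move=> k; have [kN|Nk] := ltnP k N.
  rewrite (bigD1 (Ordinal kN)) //= addrCA lerDl addr_ge0 // sumr_ge0 // => j _.
  by rewrite mulr_ge0 ?nrm_ge0 // exprn_ge0 // ltW.
apply: (@le_trans _ _ 2); last first.
  by rewrite lerDl sumr_ge0 // => j _; rewrite mulr_ge0 ?nrm_ge0 // exprn_ge0 // ltW.
have := HN k Nk; have := HN k.+1 (leqW Nk); rewrite big_ord_recr /=.
set S := \sum_(i < k) _; move=> h1 h2.
have -> : nrm (c k) * s ^+ k = nrm (w ^+ k *: c k).
  by rewrite nrmZ nrmcX nw mulrC.
have -> : w ^+ k *: c k = (f w - S) - (f w - (S + w ^+ k *: c k)).
  by rewrite opprB addrC addrA subrK addrC addKr.
by apply: le_trans (nrmB _ _) _; rewrite (_ : 2 = 1 + 1) ?lerD // ltW.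
Qed.

(** If the coefficients below m vanish, then at a zero w the term w^m c_m is balanced by the tail,
    which is of order |w|^(m+1); so |c_m| <= K |w| for arbitrarily small w. *)
Lemma power_series_coef0 :
  (forall e : R, 0 < e -> exists w, [/\ w != 0, nrm w < e & f w = 0]) ->
  forall k, c k = 0.
Proof.
move=> zeros; have s0 : 0 < r / 2 by rewrite divr_gt0.
have sr : r / 2 < r by lra.
have [|M M0 cM] := @power_series_bounded (r / 2); first by rewrite s0.
move: (r / 2) s0 sr cM => s s0 sr cM.
elim/ltn_ind => m IH; apply/eqP; rewrite -nrm_eq0 eq_le nrm_ge0 andbT.
have small w : w != 0 -> nrm w < s / 2 -> f w = 0 ->
    nrm (c m) <= 2 * M / s ^+ m.+1 * nrm w.
  move=> w0 ws fw; pose q := nrm w / s.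
  have wp : 0 < nrm w by rewrite lt0r nrm_eq0 w0 nrm_ge0.
  have q0 : 0 < q by rewrite divr_gt0.
  have q2 : 2 * q <= 1 by rewrite /q mulrA ler_pdivrMr // mul1r; lra.
  have wq : nrm w = s * q by rewrite /q mulrC divfK // lt0r_neq0.
  have term k : nrm (w ^+ k *: c k) <= M * q ^+ k.
    rewrite nrmZ nrmcX wq exprMn mulrAC (mulrC (s ^+ k)).
    by rewrite ler_wpM2r ?cM // exprn_ge0 // ltW.
  (* The bound 2 - 2 q^j for 1 + q + ... + q^(j-1) is inductive because 2q <= 1. *)
  have low j : nrm w ^+ m * nrm (c m) <=
      nrm (\sum_(k < m.+1 + j) w ^+ k *: c k) + M * q ^+ m.+1 * (2 - 2 * q ^+ j).
    elim: j => [|j IHj].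
      rewrite addn0 big_ord_recr /= big1 ?add0r => [|k _]; last by rewrite IH ?scaler0.
      by rewrite nrmZ nrmcX expr0 mulr1 subrr mulr0 addr0.
    apply: le_trans IHj _; rewrite addnS.
    have := term (m.+1 + j)%N; rewrite [q ^+ _]exprD mulrA.
    move: (m.+1 + j)%N => n; rewrite (big_ord_recr n) /=.
    set S := \sum_(k < n) _; set t := _ *: _ => ht.
    have h1 : nrm S <= nrm (S + t) + nrm t.
      by rewrite -{1}(addrK t S) nrmB.
    have Mq : 0 <= M * q ^+ m.+1 by rewrite mulr_ge0 // exprn_ge0 // ltW.
    have qj : 0 <= q ^+ j by rewrite exprn_ge0 // ltW.
    rewrite (exprS q j).
    move: (M * _) (q ^+ j) Mq qj ht => a b a0 b0 ht.
    have : a * (b * (2 * q)) <= a * b by rewrite ler_wpM2l // -[leRHS]mulr1 ler_wpM2l.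
    by move: ht h1; lra.
  have up : nrm w ^+ m * nrm (c m) <= 2 * M * q ^+ m.+1.
    apply/ler_addgt0Pr => e e0.
    have wr : nrm w < r by move: ws sr; lra.
    have [N HN] := (cvg_nrmP _ _).1 (fE wr) e e0.
    have := HN (m.+1 + N)%N (leq_addl _ _); rewrite fw sub0r nrmN => /ltW h.
    apply: le_trans (low N) _; rewrite addrC; apply: lerD h.
    have qN : 0 <= q ^+ N by rewrite exprn_ge0 // ltW.
    have Mq : 0 <= M * q ^+ m.+1 by rewrite mulr_ge0 // exprn_ge0 // ltW.
    by rewrite -(mulrA 2); move: (M * _) (q ^+ N) Mq qN => x y; nra.
  rewrite -(@ler_pM2l _ (nrm w ^+ m)) ?exprn_gt0 //; apply: le_trans up _.
  rewrite /q expr_div_n exprS le_eqVlt; apply/orP; left; apply/eqP; ring.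
apply/ler_addgt0Pr => e e0; rewrite add0r.
pose K := 2 * M / s ^+ m.+1.
have K0 : 0 <= K by rewrite divr_ge0 ?mulr_ge0 // exprn_ge0 // ltW.
have K1 : 0 < K + 1 by rewrite ltr_wpDl.
have [|w [w0 we fw]] := zeros (Num.min (s / 2) (e / (K + 1))).
  by rewrite lt_min !divr_gt0.
move: we; rewrite lt_min => /andP[ws we].
apply: le_trans (small w w0 ws fw) _; rewrite -/K.
move: we; rewrite ltr_pdivlMr // => /ltW; apply: le_trans.
by rewrite mulrC ler_wpM2l ?nrm_ge0 // lerDl.
Qed.

Lemma power_series_eq0 : (forall k, c k = 0) -> forall w, nrm w < r -> f w = 0.
Proof.
move=> c0 w wr; apply/eqP; rewrite -nrm_eq0 eq_le nrm_ge0 andbT.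
apply/ler_addgt0Pr => e e0; rewrite add0r.
have [N HN] := (cvg_nrmP _ _).1 (fE wr) e e0.
have := HN N (leqnn N); rewrite big1 ?subr0 => [/ltW //|k _].
by rewrite c0 scaler0.
Qed.

End PowerSeries.

(** Local vanishing is carried along the segment from 0 to z: being zero near a point is an open
    condition, and it is closed because zeros accumulating at a point kill the expansion there. *)
Lemma entire_eq0 (f : R[i] -> C) : entire_in f ->
  (forall t : R, f t%:C = 0) -> forall z, f z = 0.
Proof.
move=> fan freal z.
have local (z0 : R[i]) : exists2 r : R, 0 < r &
    (forall e : R, 0 < e -> exists w, [/\ w != 0, nrm w < e & f (z0 + w) = 0]) ->
    forall w, nrm (w - z0) < r -> f w = 0.
  have [r [r0 [c hc]]] := fan z0; exists r => // zeros w wr.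
  have fE w' : nrm w' < r ->
      (fun n : nat => \sum_(k < n) w' ^+ k *: c k) @ \oo --> f (z0 + w').
    move=> h; have := hc (z0 + w'); rewrite addrAC subrr add0r; apply.
    by rewrite nrmE ltcR.
  have := power_series_eq0 fE (power_series_coef0 r0 fE zeros) wr.
  by rewrite addrC subrK.
pose P (t : R) := exists2 d : R, 0 < d & forall w, nrm (w - t%:C * z) < d -> f w = 0.
have P0 : P 0.
  have [r r0 hr] := local 0; exists r => // w; rewrite mul0r; apply: hr => e e0.
  exists (e / 2)%:C; rewrite add0r freal nrmc_real gtr0_norm ?divr_gt0 //; split=> //.
    by rewrite (inj_eq (@complexI R) _ 0) lt0r_neq0 ?divr_gt0.
  by lra.
suff [d d0 hd] : P 1 by apply: hd; rewrite mul1r subrr nrm0.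
have [z0|z0] := eqVneq z 0.
  by case: P0 => d d0 hd; exists d => // w; have := hd w; rewrite z0 !mulr0; apply.
have nz : 0 < nrm z by rewrite lt0r nrm_eq0 z0 nrm_ge0.
apply: (@interval_induction _ P P0) => //.
- move=> t [d d0 hd]; exists (d / (2 * nrm z)); first by rewrite divr_gt0 // mulr_gt0.
  move=> t'; rewrite ltr_pdivlMr ?mulr_gt0 // => tt.
  exists (d / 2) => [|w wt]; first by rewrite divr_gt0.
  apply: hd; apply: le_lt_trans (nrm_distD (t'%:C * z) _ _) _.
  by rewrite -mulrBl nrmcM -rmorphB nrmc_real; move: wt tt; lra.
- move=> t t0 ht; have [r r0 hr] := local (t%:C * z); exists r => //; apply: hr => e e0.
  pose d := Num.min (t / 2) (e / (2 * nrm z)).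
  have d0 : 0 < d by rewrite lt_min !divr_gt0 // mulr_gt0.
  (* A short step back towards 0, where vanishing is already known. *)
  exists (- d%:C * z); split.
  + by rewrite mulf_neq0 // oppr_eq0 (inj_eq (@complexI R) _ 0) lt0r_neq0.
  + rewrite nrmcM nrmN nrmc_real gtr0_norm //.
    have : d <= e / (2 * nrm z) by rewrite ge_min lexx orbT.
    by rewrite ler_pdivlMr ?mulr_gt0 //; lra.
  have dt : d <= t / 2 by rewrite ge_min lexx.
  have [|d' d'0 hd'] := ht (t - d); first by apply/andP; split; lra.
  by apply: hd'; rewrite rmorphB mulrBl mulNr subrr nrm0.
Qed.

End IdentityTheorem.

(** Applying phi(b . ) to the expansions of F gives scalar expansions, so the values on the real
    line determine those of any extension F. *)
Lemma entire_exponential_unique (R : realType) (A : cstarAlgType R)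
    (phi : {scalar A}) (b : A) (F : R[i] -> A) (l k : R[i]) :
  (forall x, nrm (phi x) <= nrm x) -> entire F ->
  (forall t : R, phi (b ** F t%:C) = cexp (l * t%:C) * k) ->
  forall z, phi (b ** F z) = cexp (l * z) * k.
Proof.
move=> phi1 entF FR z; apply/eqP; rewrite -subr_eq0; apply/eqP.
pose f z : R[i]^o := phi (b ** F z) - cexp (l * z) * k.
apply: (@entire_eq0 _ f) => [|t]; last by rewrite /f FR subrr.
move=> z0; have [r [r0 [c hc]]] := entF z0.
have [r' [r'0 [c' hc']]] := @entire_cexpZ R R[i]^o l k z0.
exists (Num.min r r'); split; first by rewrite lt_min r0.
exists (fun n => phi (b ** c n) - c' n) => w.
rewrite nrmE ltcR lt_min -!ltcR -nrmE => /andP[wr wr'].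
pose S n : R[i]^o := \sum_(k < n) (w - z0) ^+ k *: (phi (b ** c k) : R[i]^o).
pose S' n : R[i]^o := \sum_(k < n) (w - z0) ^+ k *: c' k.
have hb' : S' @ \oo --> (cexp (l * w) *: k : R[i]^o) := hc' w wr'.
have hb : S @ \oo --> (phi (b ** F w) : R[i]^o).
  apply/cvg_nrmP => e e0.
  have b1 : 0 < nrm b + 1 by rewrite ltr_wpDl ?nrm_ge0.
  have [|N HN] := (cvg_nrmP _ _).1 (hc w wr) (e / (nrm b + 1)); first by rewrite divr_gt0.
  exists N => n Nn; have := HN n Nn; rewrite ltr_pdivlMr // => h.
  apply: le_lt_trans h.
  have -> : S n = phi (b ** \sum_(k < n) (w - z0) ^+ k *: c k).
    rewrite /S cmul_sumr linear_sum; apply: eq_bigr => j _.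
    by rewrite cmulZr linearZ.
  rewrite -linearB -cmulBr; apply: le_trans (phi1 _) _; apply: le_trans (nrmM _ _) _.
  by rewrite mulrC ler_wpM2l ?nrm_ge0 // lerDl.
have -> : (fun n : nat =>
      \sum_(k < n) (w - z0) ^+ k *: (phi (b ** c k) - c' k : R[i]^o)) =
    (fun n => S n - S' n).
  apply/funext => n; rewrite /S /S' -sumrB; apply: eq_bigr => j _.
  by rewrite scalerBr.
exact: cvgB hb hb'.
Qed.

(** * KMS and ground states of the Toeplitz algebra *)

Lemma scalar_functional (R : realType) (A : cstarAlgType R) (f : A -> R[i]) :
  (forall (k : R[i]) x y, f (k *: x + y) = k * f x + f y) ->
  exists psi : {scalar A}, forall x, psi x = f x.
Proof.
move=> lf.
pose g : A -> R[i] := f.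
have lg : linear_for *%R g by exact: lf.
pose gL := GRing.isLinear.Build _ _ _ _ g lg.
pose gS : {scalar A} := HB.pack g gL.
by exists gS.
Qed.

Section Toeplitz.
Context {R : realType} {E : digraph} {T : cstarAlgType R}.
Context {p : vertex E -> T} {s : edge E -> T}.
Hypothesis toeplitz : is_toeplitz_algebra p s.

Let family : is_TCK_family p s. Proof. by case: toeplitz. Qed.
Let generated : cstar_generates (range p `|` range s).
Proof. by case: toeplitz. Qed.

Local Notation u := (vertex_sum (P := p)).
Local Notation span := (span_elt p s).

Let unitP x : u ** x = x /\ x ** u = x.
Proof. exact: vertex_sum_unit family generated x. Qed.

Lemma eq_on_span_elts (f g : T -> R[i]) (C : R) :
  (forall (k : R[i]) x y, f (k *: x + y) = k * f x + f y) ->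
  (forall (k : R[i]) x y, g (k *: x + y) = k * g x + g y) ->
  (forall x, nrm (f x) <= C * nrm x) -> (forall x, nrm (g x) <= C * nrm x) ->
  (forall mu nu, f (span mu nu) = g (span mu nu)) -> forall x, f x = g x.
Proof.
move=> lf lg fC gC fg x; apply/eqP; rewrite -subr_eq0; apply/eqP.
pose h x : R[i]^o := f x - g x.
have lh (k : R[i]) y z : h (k *: y + z) = k * h y + h z.
  by rewrite /h lf lg opprD addrACA mulrBr.
apply: (@closed_subspace_span_elts _ _ _ _ _ family generated [set x | h x = 0]).
- apply: (@closed_eq0 _ _ _ _ (C + C)) => y z.
  have -> : h y - h z = h (y - z).
    by rewrite [in RHS]addrC -(scaleN1r z) lh mulN1r addrC.
  by rewrite mulrDl; apply: le_trans (nrmB _ _) _; rewrite lerD.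
- split=> [|k y z hy hz]; last first.
    by rewrite /= lh (hy : h y = 0) (hz : h z = 0) mulr0 addr0.
  have := lh (-1) 0 0; rewrite scaler0 addr0 mulN1r addNr; exact.
- by move=> _ [mu [nu ->]]; rewrite /= /h fg subrr.
Qed.

Section Dynamics.
Context {gamma : R[i] -> T -> T}.
Hypothesis gauge : is_gauge_action p s gamma.
Local Notation alpha := (gauge_dynamics gamma).

Definition degree (mu nu : gpath E) : int := (path_len mu)%:Z - (path_len nu)%:Z.

Let alphaE t : alpha t = gamma (cexp ('i%C * t%:C)).
Proof. by rewrite cexp_imaginary. Qed.

Let unit_circle t : `|cexp ('i%C * t%:C : R[i])| = 1.
Proof.
rewrite nrmE nrm_cexp (_ : complex.Re _ = 0) ?expR0 //=.
by rewrite mul0r mulr0 subrr.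
Qed.

Lemma alpha_starhom t : is_starhom (alpha t).
Proof. by rewrite alphaE; have [/(_ _ (unit_circle t))[]] := gauge. Qed.

Lemma alpha_unit t : alpha t u = u.
Proof.
have [_ [g gK Kg]] : is_automorphism (alpha t).
  by rewrite alphaE; have [/(_ _ (unit_circle t))] := gauge.
have [_ aM _] := alpha_starhom t.
by rewrite -[LHS](unitP _).2 -{2}(Kg u) -aM (unitP _).1 Kg.
Qed.

Lemma alpha_span_elt t mu nu : alpha t (span mu nu) =
  cexp ('i%C * (degree mu nu)%:~R * t%:C) *: span mu nu.
Proof.
have [_ _ /(_ _ mu nu (unit_circle t))] := gauge; rewrite alphaE => ->.
by rewrite cexp_int; congr (cexp _ *: _); rewrite mulrCA mulrA.
Qed.

Lemma span_elt_extension mu nu : entire_extension alpha (span mu nu)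
  (fun z => cexp ('i%C * (degree mu nu)%:~R * z) *: span mu nu).
Proof.
split=> [|t]; first exact: entire_cexpZ.
by rewrite alpha_span_elt.
Qed.

End Dynamics.

End Toeplitz.

(** * From the formula to the KMS condition *)

Section KMSFormula.
Context {R : realType} {E : digraph} {T : cstarAlgType R}.
Context {p : vertex E -> T} {s : edge E -> T}.
Hypothesis toeplitz : is_toeplitz_algebra p s.
Context {gamma : R[i] -> T -> T}.
Hypothesis gauge : is_gauge_action p s gamma.
Local Notation alpha := (gauge_dynamics gamma).
Local Notation u := (vertex_sum (P := p)).
Local Notation span := (span_elt p s).

Let family : is_TCK_family p s. Proof. by case: toeplitz. Qed.
Let unitP x : u ** x = x /\ x ** u = x.
Proof. by case: toeplitz => _ generated _; exact: vertex_sum_unit family generated x. Qed.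

Context {phi : {scalar T}} {beta : R}.
Hypothesis state : is_state phi.

Definition KMS_formula : Prop := forall mu nu : gpath E,
  phi (span mu nu) = (mu == nu)%:R * (expR (- (beta * (path_len mu)%:R)))%:C
    * phi (p (path_src mu)).

Let phi_nrm a : nrm (phi a) <= nrm a := state_nrm unitP state a.

Let phiZ (k : R[i]) x : phi (k *: x) = k * phi x.
Proof. exact: linearZ. Qed.

Lemma scalar_mull_lin a (k : R[i]) x y :
  phi (a ** (k *: x + y)) = k * phi (a ** x) + phi (a ** y).
Proof. by rewrite cmulDr cmulZr linearP. Qed.

Lemma scalar_mulr_lin a (k : R[i]) x y :
  phi ((k *: x + y) ** a) = k * phi (x ** a) + phi (y ** a).
Proof. by rewrite cmulDl cmulZl linearP. Qed.

Lemma state_mull_nrm a x : nrm (phi (a ** x)) <= nrm a * nrm x.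
Proof. exact: le_trans (phi_nrm _) (nrmM _ _). Qed.

Lemma state_mulr_nrm a x : nrm (phi (x ** a)) <= nrm a * nrm x.
Proof. by rewrite mulrC; exact: le_trans (phi_nrm _) (nrmM _ _). Qed.

Section FormulaImpliesKMS.
Hypothesis formula : KMS_formula.

Definition twisted (b : T) (x : R) : Prop :=
  forall a, phi (a ** b) = (expR (beta * x))%:C * phi (b ** a).

Lemma twistedM b c x y : twisted b x -> twisted c y -> twisted (b ** c) (x + y).
Proof.
move=> tb tc a; rewrite cmulA tc [c ** _]cmulA tb cmulA mulrA -rmorphM -expRD.
by rewrite mulrDr addrC.
Qed.

Lemma twisted_on_span b x :
  (forall mu nu, phi (span mu nu ** b) = (expR (beta * x))%:C * phi (b ** span mu nu)) ->
  twisted b x.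
Proof.
move=> h; pose e : R[i] := (expR (beta * x))%:C.
apply: (eq_on_span_elts toeplitz (C := nrm b + nrm e * nrm b)) => //.
- by move=> k y z; rewrite scalar_mulr_lin.
- by move=> k y z; rewrite scalar_mull_lin mulrDr mulrCA.
- move=> y; apply: le_trans (state_mulr_nrm _ _) _.
  by rewrite ler_wpM2r ?nrm_ge0 // lerDl mulr_ge0 // nrm_ge0.
- move=> y; rewrite nrmcM; apply: (@le_trans _ _ (nrm e * nrm b * nrm y)).
    by rewrite -mulrA ler_wpM2l ?nrm_ge0 // state_mull_nrm.
  by rewrite ler_wpM2r ?nrm_ge0 // lerDr nrm_ge0.
Qed.

Lemma formula_neq mu nu : mu != nu -> phi (span mu nu) = 0.
Proof. by move=> /negbTE mn; rewrite formula mn !mul0r. Qed.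

Lemma twisted_vertex v : twisted (p v) 0.
Proof.
apply: twisted_on_span => mu nu; rewrite mulr0 expR0 mul1r.
have -> : p v ** span mu nu = star (span nu mu ** p v).
  by rewrite starM star_span_elt (family_star family).
rewrite !(span_elt_mulP family) starZ conjc_nat star_span_elt !linearZ /=.
by have [->//|mn] := eqVneq mu nu; rewrite formula_neq // !mulr0.
Qed.

(** Both sides live on nu = e mu, where s_nu^* s_e = s_mu^* ; the factor e^beta pays for the extra
    edge. *)
Lemma twisted_edge e : twisted (s e) 1.
Proof.
apply: twisted_on_span => mu nu; rewrite mulr1.
have sE : s e ** span mu nu = star (span nu mu ** star (s e)).
  by rewrite starM star_span_elt starK.
have len_neq (ka la : gpath E) : path_len ka <> path_len la -> ka != la.
  by move=> kl; apply/eqP => kaE; apply: kl; rewrite kaE.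
case nuE : (val nu).2 => [|f fs].
  (* When [nu] is a vertex both sides vanish: [mu] has received an edge, whereas the other path has
     length 0. *)
  transitivity (0 : R[i]).
    have [->|[mu' [-> mu'E]]] := span_elt_mulS_vertex family mu e nuE.
      by rewrite linear0.
    apply: formula_neq; apply: len_neq; rewrite /path_len mu'E /=.
    by rewrite size_rcons.
  rewrite sE; have [[_ ->]|[mu' [_ -> mu'E]]] := span_elt_mul_starS family nu mu e.
    by rewrite star0 linear0 mulr0.
  rewrite star_span_elt formula_neq ?mulr0 //; apply: len_neq.
  by rewrite /path_len mu'E nuE.
have [nu' [-> nu'E]] := span_elt_mulS_edge family mu e nuE.
have rf : rng f = (val nu).1.
  by have := valP nu; rewrite [is_path _ _]/= nuE /= => /andP[/eqP].
rewrite linearZ /= formula sE.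
have [[smu ->]|[mu' [smu -> mu'E]]] := span_elt_mul_starS family nu mu e.
  (* Here r(mu) differs from s(e), while [nu'] has range s(f); so f = e excludes mu = [nu']. *)
  rewrite star0 linear0 mulr0; have [fe|_] := eqVneq f e; last by rewrite mul0r.
  have [munu|_] := eqVneq mu nu'; last by rewrite !mul0r mulr0.
  by case: smu; rewrite munu nu'E fe.
rewrite star_span_elt formula.
have -> : path_src mu' = path_src mu.
  by rewrite !path_srcE mu'E /path_end /= smu.
have -> : (mu' == nu) = (f == e) && (mu == nu').
  rewrite -!val_eqE (surjective_pairing (val nu)) nuE mu'E nu'E.
  rewrite (surjective_pairing (val mu)) -smu -rf !xpair_eqE eqseq_cons (eq_sym e).
  by have [->|_] := eqVneq f e; rewrite ?eqxx ?andbF.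
rewrite /path_len mu'E /=.
case: (f == e); rewrite ?mul0r ?mulr0 //= !mul1r.
rewrite !mulrA [(expR beta)%:C * _]mulrC -[in RHS](mulrA _%:R) -rmorphM -expRD.
by rewrite -natr1 mulrDr mulr1 opprD [beta + _]addrC subrK.
Qed.

Lemma twisted_star b x : twisted b x -> twisted (star b) (- x).
Proof.
move=> tb a; have ps c : phi (star c) = conjc (phi c).
  exact: (positive_star unitP (state_ge0 state)).
rewrite -[a]starK -starM ps -[star b ** _]starM ps tb rmorphM.
rewrite [X in _ * (X * _)](conjc_real _) mulrA -rmorphM -expRD.
by rewrite mulrN addNr expR0 mul1r.
Qed.

Lemma twisted_word v es : is_path v es ->
  twisted (word v es (P := p) (S := s)) (size es)%:R.
Proof.
elim: es v => [|e es IH] v /=; first by move=> _; exact: twisted_vertex.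
by move=> /andP[_ pes]; rewrite -nat1r; apply: twistedM (twisted_edge e) (IH _ pes).
Qed.

Lemma twisted_span mu nu : twisted (span mu nu) (degree mu nu)%:~R.
Proof.
rewrite (span_eltE family) /degree intrB -!pmulrn; apply: twistedM.
  by apply: twisted_word; exact: valP mu.
by apply: twisted_star; apply: twisted_word; exact: valP nu.
Qed.

(** The bound needed for the density argument comes from positivity of phi composed with [alpha t],
    together with its value 1 at the unit. *)
Lemma formula_invariant t x : phi (alpha t x) = phi x.
Proof.
have [aL aM aS] := alpha_starhom gauge t.
have [|psi psiE] := @scalar_functional _ _ (fun x => phi (alpha t x)).
  by move=> k y z; rewrite aL linearP.
have psi0 c : 0 <= psi (star c ** c).
  by rewrite psiE aM aS; exact: state_ge0.
apply: (eq_on_span_elts toeplitz (f := fun x => phi (alpha t x)) (g := phi) (C := 1)).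
- by move=> k y z; rewrite aL linearP.
- by move=> k y z; rewrite linearP.
- move=> y; rewrite -psiE; have := positive_nrm unitP psi0 y.
  by rewrite !psiE (alpha_unit toeplitz gauge) (state_unit unitP state).
- by move=> y; rewrite mul1r.
move=> mu nu; rewrite (alpha_span_elt gauge) linearZ /=.
have [->|mn] := eqVneq mu nu; last by rewrite formula_neq // mulr0.
by rewrite /degree subrr mulr0 mul0r cexp0 mul1r.
Qed.

(** The density argument runs over b, because the extension F is tied to a. *)
Lemma formula_KMS : is_KMS_state alpha beta phi.
Proof.
split=> //; case: eqP => [b0|_].
  split; last exact: formula_invariant.
  move=> a; apply: (eq_on_span_elts toeplitz (C := nrm a)).
  - by move=> k y z; rewrite scalar_mull_lin.
  - by move=> k y z; rewrite scalar_mulr_lin.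
  - by move=> y; exact: state_mull_nrm.
  - by move=> y; exact: state_mulr_nrm.
  - by move=> mu nu; rewrite twisted_span b0 mul0r expR0 mul1r.
move=> a b F [entF FR] _; set z := 0 +i* beta.
apply: (eq_on_span_elts toeplitz (f := fun b => phi (a ** b))
  (g := fun b => phi (b ** F z)) (C := nrm a + nrm (F z))).
- by move=> k x y; rewrite scalar_mull_lin.
- by move=> k x y; rewrite scalar_mulr_lin.
- by move=> x; rewrite mulrDl; apply: ler_wpDr;
    [rewrite mulr_ge0 ?nrm_ge0|exact: state_mull_nrm].
- by move=> x; rewrite mulrDl; apply: ler_wpDl;
    [rewrite mulr_ge0 ?nrm_ge0|exact: state_mulr_nrm].
move=> mu nu; set x := span mu nu; set d := degree mu nu.
(* By invariance the time evolution moves from a to the spanning element x, which is an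
   eigenvector. *)
have h t : phi (x ** F t%:C) = cexp (- ('i%C * d%:~R) * t%:C) * phi (x ** a).
  have [_ aM _] := alpha_starhom gauge t.
  rewrite FR -(formula_invariant t (x ** a)) aM (alpha_span_elt gauge) cmulZl.
  by rewrite phiZ mulrA -cexpD mulNr addNr cexp0 mul1r.
rewrite (entire_exponential_unique phi_nrm entF h) twisted_span; congr (_ * _).
rewrite -cexp_real; congr (cexp _).
rewrite /z imaginaryE.
rewrite mulNr mulrACA -expr2 sqr_i mulN1r opprK rmorphM mulrC.
by rewrite rmorph_int.
Qed.

End FormulaImpliesKMS.
End KMSFormula.

(** * From the KMS condition to the formula; ground states *)

Section Conclusion.
Context {R : realType} {E : digraph} {T : cstarAlgType R}.
Context {p : vertex E -> T} {s : edge E -> T}.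
Hypothesis toeplitz : is_toeplitz_algebra p s.
Context {gamma : R[i] -> T -> T}.
Hypothesis gauge : is_gauge_action p s gamma.
Local Notation alpha := (gauge_dynamics gamma).
Local Notation u := (vertex_sum (P := p)).
Local Notation span := (span_elt p s).

Let family : is_TCK_family p s. Proof. by case: toeplitz. Qed.
Let unitP x : u ** x = x /\ x ** u = x.
Proof. by case: toeplitz => _ generated _; exact: vertex_sum_unit family generated x. Qed.

Context {phi : {scalar T}} {beta : R}.

Let phiZ (k : R[i]) x : phi (k *: x) = k * phi x.
Proof. exact: linearZ. Qed.

Lemma s_path_span_eltM mu nu :
  span mu (vertex_path (path_src mu)) ** span (vertex_path (path_src nu)) nu =
  s_path p s mu ** star (s_path p s nu).
Proof.
by rewrite -(star_span_elt nu) !(span_elt_vertex_path family).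
Qed.

Lemma star_s_path_mul mu nu : path_len mu = path_len nu ->
  star (s_path p s nu) ** s_path p s mu = (mu == nu)%:R *: p (path_src mu).
Proof.
move=> len; rewrite !(s_pathE family) (star_word_word family) -?path_srcE.
- rewrite -!surjective_pairing (inj_eq val_inj) eq_sym.
  by have [->//|_] := eqVneq mu nu; rewrite !scale0r.
- exact: valP nu.
- exact: valP mu.
- by [].
Qed.

Lemma KMS_twist mu nu ka la : is_KMS_state alpha beta phi ->
  phi (span mu nu ** span ka la) =
  (expR (- (beta * (degree mu nu)%:~R)))%:C * phi (span ka la ** span mu nu).
Proof.
move=> [_]; case: eqP => [-> [tr _]|_ kms].
  by rewrite tr mul0r oppr0 expR0 mul1r.
rewrite (kms _ _ _ (span_elt_extension gauge mu nu)); last first.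
  by eexists; exact: (span_elt_extension gauge ka la).
rewrite cmulZr phiZ; congr (_ * _); rewrite -cexp_real; congr (cexp _).
rewrite imaginaryE.
rewrite mulrACA -expr2 sqr_i mulN1r rmorphN rmorphM mulrC.
by rewrite rmorph_int.
Qed.

(** For beta <> 0, writing x = xu = ux with u a sum of vertex projections gives phi(x) = e^(-beta d)
    phi(x), where d <> 0. For beta = 0 the twist is trivial, and invariance at time pi/d gives
    phi(x) = - phi(x). *)
Lemma KMS_degree_neq0 mu nu : is_KMS_state alpha beta phi ->
  path_len mu <> path_len nu -> phi (span mu nu) = 0.
Proof.
move=> kms len.
have d0 : (degree mu nu)%:~R != 0 :> R.
  by rewrite intr_eq0 /degree subr_eq0; apply/eqP => -[].
have [b0|b0] := eqVneq beta 0.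
  have [_] := kms; rewrite b0 eqxx => -[_ /(_ (pi / (degree mu nu)%:~R) (span mu nu))].
  rewrite (alpha_span_elt gauge) phiZ -mulrA -(rmorph_int (real_complex R)) -rmorphM.
  rewrite [_ * (pi / _)]mulrC divfK // cexp_imaginary cospi sinpi.
  rewrite (_ : -1 +i* 0 = -1 :> R[i]) ?mulN1r; last first.
    by apply/eqP; rewrite eq_complex /= oppr0 !eqxx.
  move/eqP; rewrite eq_sym -addr_eq0 -mulr2n -mulr_natl mulf_eq0 pnatr_eq0 /=.
  by move/eqP.
pose e : R := expR (- (beta * (degree mu nu)%:~R)).
have h : phi (span mu nu) = e%:C * phi (span mu nu).
  rewrite -{1}(unitP (span mu nu)).2 -{2}(unitP (span mu nu)).1.
  rewrite cmul_sumr cmul_suml !linear_sum mulr_sumr; apply: eq_bigr => v _.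
  by rewrite -(span_elt_vertex family) KMS_twist.
have e1 : e != 1.
  rewrite /e -[X in _ != X]expR0 (inj_eq (@expR_inj R)) oppr_eq0 mulf_eq0 negb_or b0 d0.
  by [].
apply/eqP; move/eqP: h; rewrite -subr_eq0 -{1}[phi _]mul1r -mulrBl mulf_eq0.
rewrite subr_eq0 => /orP[|//]; rewrite eq_sym -(rmorph1 (real_complex R)).
by rewrite (inj_eq (@complexI R)) (negbTE e1).
Qed.

Lemma KMS_is_formula : is_KMS_state alpha beta phi ->
  KMS_formula (p := p) (s := s) (phi := phi) (beta := beta).
Proof.
move=> kms mu nu.
have [len|len] := eqVneq (path_len mu) (path_len nu); last first.
  rewrite (KMS_degree_neq0 kms) //; last exact/eqP.
  by have [mn|_] := eqVneq mu nu; rewrite ?mul0r // mn eqxx in len *.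
rewrite /span_elt -s_path_span_eltM KMS_twist //.
rewrite -[span (vertex_path _) nu]star_span_elt !(span_elt_vertex_path family).
rewrite star_s_path_mul // phiZ mulrCA mulrA /degree /= subr0.
by [].
Qed.

Lemma Re_imaginary_mul (d : int) (z : R[i]) :
  complex.Re ('i%C * d%:~R * z) = - d%:~R * complex.Im z.
Proof.
by rewrite -(rmorph_int (real_complex R)); case: z => x y /=; ring.
Qed.

(** For a = s_mu and b = s_nu^* , the function at z = iy/|nu| has modulus e^y |phi(ab)|, bounded
    only if phi(ab) = 0. The case |mu| > 0 follows by adjoints. *)
Lemma ground_vanish : is_ground_state alpha (span_elts p s) phi ->
  forall mu nu, (0 < path_len mu)%N \/ (0 < path_len nu)%N -> phi (span mu nu) = 0.
Proof.
move=> [state ground].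
have ps c : phi (star c) = conjc (phi c).
  exact: (positive_star unitP (state_ge0 state)).
have main mu nu : (0 < path_len nu)%N -> phi (span mu nu) = 0.
  move=> nu0; pose a := span mu (vertex_path (path_src mu)).
  pose b := span (vertex_path (path_src nu)) nu.
  have ab : a ** b = span mu nu by rewrite /a /b s_path_span_eltM.
  have [||M HM] := ground a b _ _ _
    (span_elt_extension gauge (vertex_path (path_src nu)) nu).
  - by exists mu, (vertex_path (path_src mu)).
  - by exists (vertex_path (path_src nu)), nu.
  apply/eqP; rewrite -nrm_eq0 eq_le nrm_ge0 andbT leNgt; apply/negP => k0.
  have bound (y : R) : 0 < y -> expR y * nrm (phi (span mu nu)) <= M.
    move=> y0; pose z : R[i] := 'i%C * (y / (path_len nu)%:R)%:C.
    have l0 : 0 < (path_len nu)%:R :> R by rewrite ltr0n.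
    have := HM z; rewrite /z /= !(mul0r, mul1r, mulr0, add0r, addr0).
    rewrite divr_gt0 // => /(_ isT).
    rewrite cmulZr phiZ ab nrmE lecR nrmcM nrm_cexp.
    rewrite Re_imaginary_mul /= !(mul0r, mul1r, mulr0, add0r, addr0).
    have -> : degree (vertex_path (path_src nu)) nu = - (path_len nu)%:Z by exact: sub0r.
    by rewrite mulrNz opprK -pmulrn [_%:R * _]mulrC divfK // lt0r_neq0.
  (* Since e^y >= 1 + y, this y pushes the left side of [bound] above |M| + 1. *)
  have y0 : 0 < (`|M| + 1) / nrm (phi (span mu nu)) by rewrite divr_gt0 // ltr_wpDl.
  have := le_trans (ler_wpM2r (ltW k0) (expR_ge1Dx _)) (bound _ y0).
  rewrite mulrDl divfK ?lt0r_neq0 //.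
  by move: (ler_norm M) k0; lra.
move=> mu nu [mu0|]; last exact: main.
by rewrite -star_span_elt ps main // conjc0.
Qed.

(** If |ka| >= |la|, the exponential has modulus at most 1 on the upper half-plane. Otherwise ab is
    0 or a spanning element with starred path of length at least |la| > 0, so phi(ab) = 0. *)
Lemma vanish_ground : is_state phi ->
  (forall mu nu, (0 < path_len mu)%N \/ (0 < path_len nu)%N -> phi (span mu nu) = 0) ->
  is_ground_state alpha (span_elts p s) phi.
Proof.
move=> state van; split=> // _ _ F [mu [nu ->]] [ka [la ->]] [entF FR].
have FE := entire_exponential_unique (state_nrm unitP state) entF
  (b := span mu nu) (l := 'i%C * (degree ka la)%:~R) (k := phi (span mu nu ** span ka la)).
exists (nrm (phi (span mu nu ** span ka la))) => z z0; rewrite FE => [|t]; last first.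
  by rewrite FR (alpha_span_elt gauge) cmulZr phiZ.
rewrite nrmE lecR nrmcM nrm_cexp.
have [kl|lk] := leqP (path_len la) (path_len ka).
  rewrite ler_piMl ?nrm_ge0 // -[X in _ <= X]expR0 ler_expR.
  rewrite Re_imaginary_mul mulNr oppr_le0 mulr_ge0 ?(ltW z0) //.
  by rewrite ler0z /degree subr_ge0 lez_nat.
have [->|[mu' [nu' [lnu' ->]]]] := spans_span_eltM family mu nu ka la.
  by rewrite linear0 nrm0 mulr0.
rewrite van ?nrm0 ?mulr0 //; right; apply: leq_trans lnu'; exact: leq_ltn_trans lk.
Qed.

(** * Vertex weights and factorization through the quotient *)

Section Weights.
Hypothesis state : is_state phi.
Hypothesis formula : KMS_formula (p := p) (s := s) (phi := phi) (beta := beta).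

Definition edge_sum v : T := \sum_(e | rng e == v) s e ** star (s e).

Lemma formula_edge e : phi (s e ** star (s e)) = (expR (- beta))%:C * phi (p (src e)).
Proof.
have pe : is_path (rng e, [:: e]).1 (rng e, [:: e]).2 by rewrite /= eqxx.
pose mu : gpath E := exist (fun x => is_path x.1 x.2) (rng e, [:: e]) pe.
have := formula mu mu; rewrite eqxx mul1r mulr1.
by rewrite (span_eltE family) /= (family_S_src family).
Qed.

(** Each edge e contributes e^beta phi(s_e s_e^* ) = m_(s(e)); grouping the edges by source produces
    the matrix entries. *)
Lemma vertex_matrix_mul_edge_sum v :
  vertex_matrix_mul (vertex_weights p phi) v = (expR beta)%:C * phi (edge_sum v).
Proof.
rewrite /edge_sum linear_sum mulr_sumr.
under [RHS]eq_bigr => e _ do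
  rewrite formula_edge mulrA -rmorphM -expRD subrr expR0 mul1r.
rewrite (partition_big (@src E) predT) //=; apply: eq_bigr => w _.
rewrite /vertex_weights (eq_bigr (fun=> phi (p w))) => [|e /andP[_ /eqP -> //]].
rewrite sumr_const mulr_natl; congr (_ *+ _); apply: eq_card => e.
by rewrite !unfold_in; apply/asboolP/idP.
Qed.

Lemma weights_probability : is_probability (vertex_weights p phi).
Proof.
split=> [v|]; last first.
  by rewrite -(state_unit unitP state) linear_sum.
rewrite /vertex_weights; have <- : star (p v) ** p v = p v.
  by rewrite (family_star family) (family_proj family v).2.
exact: state_ge0.
Qed.

Lemma vertex_defect v : exists c, p v - edge_sum v = star c ** c.
Proof.
case: family => _ [_ [_ [_ /(_ v [set e | rng e == v]%SET)]]] h.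
have [|c cE] := h; first by move=> e; rewrite inE => /eqP.
exists c; rewrite -cE; congr (_ - _); apply: eq_bigl => e.
by rewrite inE.
Qed.

Lemma weights_subinvariant v :
  vertex_matrix_mul (vertex_weights p phi) v <= (expR beta)%:C * vertex_weights p phi v.
Proof.
rewrite vertex_matrix_mul_edge_sum ler_wpM2l ?lecR ?expR_ge0 // -subr_ge0.
by rewrite -linearB; have [c ->] := vertex_defect v; exact: state_ge0.
Qed.

Lemma weights_eqE v :
  vertex_matrix_mul (vertex_weights p phi) v = (expR beta)%:C * vertex_weights p phi v
  <-> phi (p v - edge_sum v) = 0.
Proof.
rewrite vertex_matrix_mul_edge_sum linearB /vertex_weights.
have e0 : (expR beta)%:C != 0 :> R[i].
  by rewrite (inj_eq (@complexI R) _ 0) gt_eqF // expR_gt0.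
split=> [/(mulfI e0) ->|/eqP]; first by rewrite subrr.
by rewrite subr_eq0 => /eqP ->.
Qed.

(** Cauchy-Schwarz absorbs only factors to the right of c^* c. A spanning element on the left is
    carried to the far right by [twisted_span], and density covers all left factors. *)
Lemma vanish_CK_ideal :
  (forall v, ~ is_source v -> phi (p v - edge_sum v) = 0) ->
  forall x, CK_ideal p s x -> phi x = 0.
Proof.
move=> h x; have phi_nrm := state_nrm unitP state.
(* The largest two-sided ideal inside the kernel of phi; the kernel itself need not be an ideal. *)
pose I0 := [set y : T | forall a b, phi (a ** y ** b) = 0].
move=> /(_ I0) I0x.
suff : I0 x by move=> /(_ u u); rewrite (unitP _).2 (unitP _).1.
apply: I0x.
  split.
  - apply/closed_nrmP => y hy a b; apply/eqP; rewrite -nrm_eq0 eq_le nrm_ge0 andbT.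
    apply/ler_addgt0Pr => e e0; rewrite add0r.
    have C1 : 0 < nrm a * nrm b + 1 by rewrite ltr_wpDl ?mulr_ge0 ?nrm_ge0.
    have [|z Iz yz] := hy (e / (nrm a * nrm b + 1)); first by rewrite divr_gt0.
    rewrite -[phi _]subr0 -(Iz a b) -linearB -cmulBl -cmulBr.
    move: yz; rewrite ltr_pdivlMr // => /ltW; apply: le_trans.
    apply: le_trans (phi_nrm _) _; apply: le_trans (nrmM _ _) _.
    apply: le_trans (ler_wpM2r (nrm_ge0 _) (nrmM _ _)) _.
    by rewrite mulrAC mulrC ler_wpM2l ?nrm_ge0 // lerDl.
  - split=> [a b|k y z Iy Iz a b]; first by rewrite cmul0r cmul0l linear0.
    by rewrite cmulDr cmulDl cmulZr cmulZl linearD phiZ Iy Iz mulr0 addr0.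
  - move=> a y Iy; split=> c d; first by rewrite cmulA Iy.
    by rewrite -!cmulA cmulA Iy.
move=> _ [v [vs ->]] a b.
have [c cE] := vertex_defect v; have := h v vs; rewrite -/(edge_sum v) cE => c0.
have left_kernel y : phi (star c ** c ** y) = 0.
  by rewrite -cmulA; exact: (positive_mul_eq0 unitP (state_ge0 state)).
move: a; apply: (eq_on_span_elts toeplitz (f := fun a => phi (a ** (star c ** c) ** b))
  (g := fun=> 0) (C := nrm (star c ** c ** b))).
- by move=> k y z; rewrite !cmulDl !cmulZl linearP.
- by move=> k y z; rewrite mulr0 addr0.
- by move=> y; rewrite -cmulA mulrC; exact: le_trans (phi_nrm _) (nrmM _ _).
- by move=> y; rewrite nrm0 mulr_ge0 ?nrm_ge0.
move=> mu nu.
have tw := twisted_span toeplitz state formula mu nu (star c ** c ** b).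
rewrite -cmulA left_kernel in tw.
move/eqP: tw; rewrite eq_sym mulf_eq0 (inj_eq (@complexI R) _ 0) gt_eqF ?expR_gt0 //=.
by rewrite cmulA => /eqP.
Qed.

(** Positivity descends because q is onto. The norm bound descends because phi is constant on the
    coset a + J, over which the quotient norm is the infimum. *)
Lemma factors_throughP (CE : cstarAlgType R) (q : T -> CE) :
  is_quotient_map (CK_ideal p s) q ->
  factors_through q phi <-> forall x, CK_ideal p s x -> phi x = 0.
Proof.
move=> [[qL qM qS] qsurj qker qnrm].
have q0 : q 0 = 0.
  have := qL (-1) 0 0; rewrite scaler0 addr0 scaleN1r addNr; exact.
have qD x y : q (x + y) = q x + q y by have := qL 1 x y; rewrite !scale1r.
have qN x : q (- x) = - q x by have := qL (-1) x 0; rewrite !addr0 !scaleN1r q0 addr0.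
split=> [[psi [_ psiE]] x /qker qx|van]; first by rewrite psiE qx linear0.
have [pre preK] := choice qsurj.
have phiq x y : q x = q y -> phi x = phi y.
  move=> xy; apply/eqP; rewrite -subr_eq0 -linearB; apply/eqP/van/qker.
  by rewrite qD qN xy subrr.
have [|psi psiE] := @scalar_functional _ _ (fun b => phi (pre b)).
  by move=> k x y; rewrite -linearP; apply: phiq; rewrite qL !preK.
have psiq a : psi (q a) = phi a by rewrite psiE; apply: phiq; rewrite preK.
exists psi; split=> [|a]; last by rewrite psiq.
have unitq b : q u ** b = b /\ b ** q u = b.
  by have [a <-] := qsurj b; rewrite -!qM (unitP _).1 (unitP _).2.
apply: (is_stateP unitq).
- move=> c; have [a <-] := qsurj c; rewrite -qS -qM psiq.
  exact: state_ge0.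
- move=> b; have [a <-] := qsurj b; rewrite psiq /nrm qnrm.
  apply: lb_le_inf.
    exists (complex.Re `|a + 0|); exists 0 => //.
    by apply/qker.
  move=> _ [j Jj <-]; have -> : phi a = phi (a + j).
    by rewrite linearD (van j) // addr0.
  exact: (state_nrm unitP state).
- by rewrite psiq (state_unit unitP state).
Qed.

End Weights.

End Conclusion.

Theorem proposition2p1 (R : realType) (E : digraph) (T : cstarAlgType R)
    (p : vertex E -> T) (s : edge E -> T) (hT : is_toeplitz_algebra p s)
    (gamma : R[i] -> T -> T) (hgamma : is_gauge_action p s gamma) (beta : R) :
  let alpha := gauge_dynamics gamma in
  (forall phi : {scalar T}, is_state phi ->
     (is_KMS_state alpha beta phi <->
      forall mu nu : gpath E,
        phi (span_elt p s mu nu) =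
        (mu == nu)%:R * (expR (- (beta * (path_len mu)%:R)))%:C
          * phi (p (path_src mu))))
  /\
  (forall phi : {scalar T}, is_state phi ->
     (is_ground_state alpha (span_elts p s) phi <->
      forall mu nu : gpath E, (0 < path_len mu)%N \/ (0 < path_len nu)%N ->
        phi (span_elt p s mu nu) = 0))
  /\
  (forall phi : {scalar T}, is_KMS_state alpha beta phi ->
     let m := vertex_weights p phi in
     is_probability m /\
     forall v, vertex_matrix_mul m v <= (expR beta)%:C * m v)
  /\
  (forall (CE : cstarAlgType R) (q : T -> CE),
     is_quotient_map (CK_ideal p s) q ->
     forall phi : {scalar T}, is_KMS_state alpha beta phi ->
     let m := vertex_weights p phi in
     (factors_through q phi <->
      forall v, ~ is_source v ->
        vertex_matrix_mul m v = (expR beta)%:C * m v)).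
Proof.
move=> alpha; split=> [phi state|].
  split; first exact: (KMS_is_formula hT hgamma).
  exact: (formula_KMS hT hgamma state).
split=> [phi state|].
  split; first exact: (ground_vanish hT hgamma).
  exact: (vanish_ground hT hgamma).
split=> [phi kms m|CE q qJ phi kms m].
  have formula := KMS_is_formula hT hgamma kms; have [state _] := kms.
  split; first exact: (weights_probability hT state).
  exact: (weights_subinvariant hT state formula).
have formula := KMS_is_formula hT hgamma kms; have [state _] := kms.
rewrite (factors_throughP hT state qJ); split=> [van v vs|h].
  apply/(weights_eqE hT formula); apply: van => I _; apply.
  by exists v.
apply: (vanish_CK_ideal hT state formula) => v vs.
by apply/(weights_eqE hT formula); exact: h.
Qed.
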